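(* Let $1<\alpha<2$, $0\le p\le1$, let $c\ge0$ be a constant, $N\ge1$, and suppose the penalty parameters $\rho_\pm$ and penalty functions $Q_N^\pm$ satisfy $$\rho_{-}Q_N^{-}(x)=-\sum_{k=0}^{N}\frac{1}{\gamma_{k}^{0,0}}L_{k}(x)L_{k}(-1),\qquad \rho_{+}Q_N^{+}(x)=\sum_{k=0}^{N}\frac{1}{\gamma_{k}^{0,0}}L_{k}(x)L_{k}(1).$$ Let $u_N\in\mathbb{P}_N$ be the solution of the spectral penalty scheme (weight $\omega\equiv1$) $$\mathcal{A}^C_P(u_N,v)=\langle f,v\rangle+g_1\rho_-(Q_N^-,v)+g_2\rho_+(Q_N^+,v)\quad\forall v\in\mathbb{P}_N,$$ where $$\mathcal{A}^C_P(u,v)=-\Big(\frac{d}{dx}\,{}^C\mathcal{D}_p^{\alpha-1}u,v\Big)+c(u,v)+\rho_-\,{}^C\mathcal{D}_p^{\alpha-1}u(-1)\,(Q_N^-,v)+\rho_+\,{}^C\mathcal{D}_p^{\alpha-1}u(1)\,(Q_N^+,v).$$ Then there is a constant $C>0$ independent of $N$ such that $\mathcal{A}^C_P(u_N,u_N)\ge C\,\|u_N'\|_{J^{\alpha/2-1}(\Lambda)}^2$.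
   Context: $\Lambda=(-1,1)$, $(\cdot,\cdot)$ is the $L^2(\Lambda)$ inner product, $\mathbb{P}_N$ the polynomials of degree $\le N$, $L_k$ the Legendre polynomials and $\gamma_k^{0,0}=\int_{-1}^1L_k^2\,dx=2/(2k+1)$; $f$ is a given right-hand side and $g_1,g_2$ given Caputo fractional Neumann data. Let $\mu,\nu$ be real numbers with $\alpha-2\le\mu,\nu\le0$, $\mu+\nu=\alpha-2$, $p\sin(\pi\mu)=(1-p)\sin(\pi\nu)$, $C_{\alpha,p}:=(\sin\pi\mu+\sin\pi\nu)/\sin\pi\alpha$. For $\sigma>0$, ${}_{-1}I_x^{\sigma}v(x)=\frac{1}{\Gamma(\sigma)}\int_{-1}^x (x-y)^{\sigma-1}v(y)\,dy$, ${}_{x}I_1^{\sigma}v(x)=\frac{1}{\Gamma(\sigma)}\int_x^1 (y-x)^{\sigma-1}v(y)\,dy$. The two-sided Caputo derivative is ${}^C\mathcal{D}_p^{\alpha-1}u:=C_{\alpha,p}\big(p\,{}_{-1}I_x^{2-\alpha}u'+(1-p)\,{}_{x}I_1^{2-\alpha}u'\big)$ (i.e. $C_{\alpha,p}$ times $p$ times the left Caputo derivative minus $(1-p)$ times the right Caputo derivative of order $\alpha-1$). For $\sigma\ge0$, $\|w\|_{J^{-\sigma}(\Lambda)}:=\big\||\xi|^{-\sigma}\mathcal{F}^c(w)(\xi)\big\|_{L^2(\mathbb{R})}$ with $\mathcal{F}^c(w)(\xi):=\frac{1}{2\pi}\int_{-1}^1 w(x)e^{{\rm i}\xi x}\,dx$;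 here $\sigma=1-\alpha/2$. *)

(* Defs.v *)
From HB Require Import structures.
From mathcomp Require Import all_boot all_order all_algebra.
From mathcomp Require Import all_classical all_reals all_analysis.
Set Implicit Arguments. Unset Strict Implicit. Unset Printing Implicit Defensive.
Import Order.TTheory GRing.Theory Num.Theory.
Import numFieldNormedType.Exports.
Local Open Scope classical_set_scope.
Local Open Scope ring_scope.

Section Defs.
Variable R : realType.
Notation mu := (@lebesgue_measure R).

Definition Gamma (s : R) : R :=
  Rintegral mu `]0%R, +oo[ (fun t => t `^ (s - 1) * expR (- t)).

Definition ip (u v : R -> R) : R :=
  Rintegral mu `](-1)%R, 1%R[ (fun x => u x * v x).

Definition lfrac_int (s : R) (v : R -> R) (x : R) : R :=
  (Gamma s)^-1 * Rintegral mu `[(-1)%R, x] (fun y => (x - y) `^ (s - 1) * v y).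
Definition rfrac_int (s : R) (v : R -> R) (x : R) : R :=
  (Gamma s)^-1 * Rintegral mu `[x, 1%R] (fun y => (y - x) `^ (s - 1) * v y).

Definition Calp (alpha m n : R) : R :=
  (sin (pi * m) + sin (pi * n)) / sin (pi * alpha).

Definition caputoD (alpha p m n : R) (u : {poly R}) (x : R) : R :=
  Calp alpha m n *
   (p * lfrac_int (2 - alpha) (fun y => (u^`()).[y]) x
    + (1 - p) * rfrac_int (2 - alpha) (fun y => (u^`()).[y]) x).

(* Legendre polynomials via Rodrigues: L_k = 1/(2^k k!) d^k/dx^k (x^2-1)^k. *)
Definition legendre (k : nat) : {poly R} :=
  ((2 ^+ k * (k`!)%:R)^-1) *: (((('X ^+ 2 - 1) ^+ k) : {poly R})^`(k)).

(* gamma_k^{0,0} = int_{-1}^1 L_k^2 = 2/(2k+1). *)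
Definition gamma00 (k : nat) : R := 2 / (2 * k%:R + 1).

Definition APform (alpha p m n c rhom rhop : R) (Qm Qp : R -> R)
    (u v : {poly R}) : R :=
  - ip (derive1 (caputoD alpha p m n u)) (fun x => v.[x])
  + c * ip (fun x => u.[x]) (fun x => v.[x])
  + rhom * caputoD alpha p m n u (-1) * ip Qm (fun x => v.[x])
  + rhop * caputoD alpha p m n u 1 * ip Qp (fun x => v.[x]).

(* Squared norm ||w||^2_{J^{-sigma}(Lambda)}
   = int_R |xi|^{-2 sigma} |F^c(w)(xi)|^2 dxi, where
   F^c(w)(xi) = 1/(2pi) int_{-1}^1 w(x) e^{i xi x} dx, so that
   |F^c(w)(xi)|^2 = (1/(2pi) int w cos(xi x))^2 + (1/(2pi) int w sin(xi x))^2. *)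
Definition Fc_abs2 (w : R -> R) (xi : R) : R :=
  (Rintegral mu `](-1)%R, 1%R[ (fun x => w x * cos (xi * x)) / (2 * pi)) ^+ 2
  + (Rintegral mu `](-1)%R, 1%R[ (fun x => w x * sin (xi * x)) / (2 * pi)) ^+ 2.

Definition Jneg_norm2 (sigma : R) (w : R -> R) : \bar R :=
  (\int[mu]_(xi in [set: R]) ((`|xi| `^ (- sigma)) ^+ 2 * Fc_abs2 w xi)%:E)%E.

End Defs.

(* Main.v *)
Require Import Defs.
From HB Require Import structures.
From mathcomp Require Import all_boot all_order all_algebra.
From mathcomp Require Import all_classical all_reals all_analysis.
From mathcomp Require Import measurable_realfun ring lra.
Set Implicit Arguments. Unset Strict Implicit. Unset Printing Implicit Defensive.
Import Order.TTheory GRing.Theory Num.Theory.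
Import numFieldNormedType.Exports.
Local Open Scope classical_set_scope.
Local Open Scope ring_scope.

(** Integrating by parts, and using that the weighted Legendre sums reproduce
    point values at -1 and 1 on polynomials of degree at most N, the penalty
    terms cancel the boundary terms exactly: A(u,u) = (D u, u') + c (u,u),
    where D is the two-sided Caputo derivative.  By symmetry of the kernel,
    (D u, u') is a positive multiple of the Riesz energy
      E = \int\int |x-y|^(s-1) u'(x) u'(y) dx dy,   s = 2 - alpha.
    To compare E with the negative norm, write
      Gamma(s) |xi|^(-s) = \int_0^oo t^(s-1) e^(-t|xi|) dt
    and use the Poisson kernel
      \int e^(-t|xi|) cos(xi d) dxi = 2t / (t^2 + d^2),
    whose integral against t^(s-1) dt is a constant multiple of |d|^(s-1).
    The constant obtained depends on alpha, mu and nu only. *)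

(** * Affine change of variables and power integrals *)

(** For 0 < s < 1 the function |xi|^(-s) is not integrable at infinity, so the integral of |xi|^(-s)
    cos(xi d) converges only conditionally and Fubini does not apply to it. Writing |xi|^(-s) as a
    superposition of the e^(-t|xi|) replaces it by absolutely convergent integrals. The exchange of
    xi and t rests on |F(xi)|^2 >= 0 and is made in the extended reals, so finiteness of the norm is
    a result and not an assumption. The weight u'(x) u'(y) changes sign, hence the exchange of t and
    (x, y) needs absolute integrability of the Riesz kernel. The other obstacle is at the endpoints:
    D u has the form (x+1)^s q1 + (1-x)^s q2 with polynomials q1, q2, whose derivative is in general
    unbounded near -1 and 1. Integration by parts is therefore proved for this class of functions
    directly. With K the integral of 2 t^s / (t^2 + 1) over t > 0, the final constant is C_{alpha,p}
    (2 pi)^2 / (2 K). The factor Gamma(s) cancels, as it occurs both in the fractional integrals and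
    in the representation of |xi|^(-s). *)

Section Base.
Variable R : realType.
Notation mu := (@lebesgue_measure R).

Lemma measurable_affine (a b : R) :
  measurable_fun [set: R] (fun x : R => a * x + b).
Proof.
by apply: measurable_funD => //; apply: measurable_funM.
Qed.

Definition affine_pushforward (a b : R) : {measure set (measurableTypeR R) -> \bar R} :=
  measure_function_pushforward__canonical__measure_function_Measure mu
    (measurable_affine a b : measurable_fun [set: measurableTypeR R]
      (fun x : measurableTypeR R => a * x + b : measurableTypeR R)).

(** By uniqueness of Lebesgue measure it suffices to compare lengths on intervals ]x, y]. For a < 0
    the preimage is closed on the left and open on the right, hence the two cases. *)
Lemma lebesgue_affine (a b : R) (A : set R) (a0 : a != 0) : measurable A ->
  mu A = mscale (NngNum (normr_ge0 a)) (affine_pushforward a b) A.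
Proof.
move=> mA.
rewrite (@lebesgue_measure_unique R (mscale (NngNum (normr_ge0 a)) (affine_pushforward a b)))//.
move=> _ [[x y] _ <-].
change (mu `]x, y] = (`|a|%:E * mu ((fun x0 : R => (a * x0 + b)%R) @^-1` `]x, y]))%E).
have [a_gt0|a_lt0] : 0 < a \/ a < 0 by move: a0; rewrite neq_lt => /orP[]; auto.
- have -> : (fun x0 : R => a * x0 + b) @^-1` `]x, y] =
     `](x - b) / a, (y - b) / a]%classic.
    apply/seteqP; split=> z /=; rewrite !in_itv/= ltr_pdivrMr// ler_pdivlMr// (mulrC a);
    by rewrite ltrBlDr lerBrDr.
  rewrite !lebesgue_measure_itv/= !lte_fin ltr_pM2r ?invr_gt0// ltrD2r.
  case: ifPn => _; last by rewrite mule0.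
  rewrite gtr0_norm// -!EFinD -EFinM; congr EFin.
  rewrite -mulrBl mulrCA divff// mulr1; ring.
- have -> : (fun x0 : R => a * x0 + b) @^-1` `]x, y] =
     `[(y - b) / a, (x - b) / a[%classic.
    apply/seteqP; split=> z /=; rewrite !in_itv/= ltr_ndivlMr// ler_ndivrMr// (mulrC a);
    by rewrite ltrBlDr lerBrDr// andbC.
  rewrite !lebesgue_measure_itv/= !lte_fin ltr_nM2r ?invr_lt0// ltrD2r.
  case: ifPn => _; last by rewrite mule0.
  rewrite ltr0_norm// -!EFinD -EFinM; congr EFin.
  rewrite -mulrBl mulrCA mulNr divff// mulrN1; ring.
Qed.

Lemma ge0_integral_affine (a b : R) (f : R -> \bar R) : a != 0 ->
  measurable_fun [set: R] f -> (forall x, 0 <= f x)%E ->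
  (\int[mu]_x f (a * x + b)%R = `|a|^-1%:E * \int[mu]_x f x)%E.
Proof.
move=> a0 mf f0.
have maf : measurable_fun [set: measurableTypeR R]
  (fun x : measurableTypeR R => a * x + b : measurableTypeR R).
  exact: measurable_affine.
have -> : (\int[mu]_x f x =
    \int[mscale (NngNum (normr_ge0 a)) (affine_pushforward a b)]_x f x)%E.
  by apply: eq_measure_integral => A mA _; exact: lebesgue_affine.
rewrite ge0_integral_mscale//= muleA -EFinM mulVf ?normr_eq0// mul1e.
by rewrite (ge0_integral_pushforward maf).
Qed.

Lemma Rintegral_itv_oo (a b : R) (f : R -> R) (b0 b1 : bool) :
  measurable_fun `]a, b[ f ->
  Rintegral mu [set` Interval (BSide b0 a) (BSide b1 b)] f = Rintegral mu `]a, b[ f.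
Proof.
move=> mf; rewrite /Rintegral integral_itv_bndoo//; exact/measurable_EFinP.
Qed.

Lemma continuous_powR_gt0 (s x : R) : 0 < x -> {for x, continuous (fun y : R => y `^ s)}.
Proof.
move=> x0; apply: differentiable_continuous; apply/derivable1_diffP.
by apply: derivable_powR; rewrite in_itv/= x0.
Qed.

Lemma continuous_powR_ge0 (s x : R) : 0 < s -> {for x, continuous (fun y : R => `|y| `^ s)}.
Proof.
move=> s0; have [->|x0] := eqVneq x 0.
  rewrite /prop_for /continuous_at normr0 powR0 ?gt_eqF//.
  apply/cvgrPdist_lt => /= e e0.
  near=> y; rewrite sub0r normrN ger0_norm ?powR_ge0//.
  have : `|y| < e `^ s^-1.
    near: y; exists (e `^ s^-1) => /=; first exact: powR_gt0.
    by move=> y /=; rewrite sub0r normrN.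
  move=> /(gt0_ltr_powR s0); rewrite !nnegrE normr_ge0 powR_ge0 => /(_ isT isT).
  by rewrite -powRrM mulVf ?gt_eqF// powRr1 ?ltW.
apply: (@continuous_comp _ _ _ (fun y : R => `|y|) (fun y => y `^ s)).
  exact: norm_continuous.
by apply: continuous_powR_gt0; rewrite normr_gt0.
Unshelve. all: end_near. Qed.

(** The integrand may blow up at 0, so the fundamental theorem is applied on intervals away from 0
    and the limit is taken by monotone convergence. *)
Lemma integral_powR (s b : R) : 0 < s -> 0 <= b ->
  (\int[mu]_(x in `[0%R, b]) (x `^ (s - 1))%:E = (b `^ s / s)%:E)%E.
Proof.
move=> s0; rewrite le_eqVlt => /predU1P[<-|b0].
  by rewrite set_itv1 integral_set1 powR0 ?mul0r// gt_eqF.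
rewrite (@integral_itv_bndoo _ _ _ _ true false); last first.
  by apply/measurable_EFinP/measurable_funTS; exact: measurable_powR.
rewrite -(@integral_itv_bndoo _ _ _ _ false false); last first.
  by apply/measurable_EFinP/measurable_funTS; exact: measurable_powR.
(* The shift by 2 makes b / (n + 2) strictly smaller than b already for n = 0, so no interval
   degenerates. *)
pose F n : set R := `[b / n.+2%:R, b]%classic.
have bn n : 0 < b / n.+2%:R < b.
  by rewrite divr_gt0//= ltr_pdivrMr// ltr_pMr// (ltr_nat _ 1).
have -> : `]0, b]%classic = \bigcup_n F n.
  apply/seteqP; split=> x /=.
    rewrite in_itv/= => /andP[x0 xb].
    have [n _ Hn] := @near_infty_natSinv_lt R (PosNum (divr_gt0 x0 b0)).
    exists n => //=; rewrite /F/= in_itv/= xb andbT.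
    have /= := Hn n.+1 (leqnSn n); rewrite ltr_pdivlMr// mulrC => /ltW //.
  move=> [n _ /=]; rewrite /F/= !in_itv/= => /andP[h1 ->]; rewrite andbT.
  by apply: lt_le_trans h1; case/andP: (bn n).
have cvg1 := @ge0_nondecreasing_set_cvg_integral _ (measurableTypeR R) R F (fun x : R => (x `^ (s - 1))%:E) mu.
have FE n : (\int[mu]_(x in F n) (x `^ (s - 1))%:E =
    (b `^ s / s)%:E - ((b / n.+2%:R) `^ s / s)%:E)%E.
  have /andP[h0 h1] := bn n.
  rewrite (@continuous_FTC2 _ _ (fun x => x `^ s / s))//.
  - apply: continuous_in_subspaceT => x; rewrite inE/= in_itv/= => /andP[xl _].
    by apply: continuous_powR_gt0; exact: lt_le_trans xl.
  - split.
    + move=> x; rewrite in_itv/= => /andP[xl _].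
      apply: derivableM => //; apply: derivable_powR.
      by rewrite in_itv/= andbT (lt_trans h0).
    + apply: cvg_at_right_filter; apply: cvgM; last exact: cvg_cst.
      exact: continuous_powR_gt0.
    + apply: cvg_at_left_filter; apply: cvgM; last exact: cvg_cst.
      exact: continuous_powR_gt0.
  - move=> x; rewrite in_itv/= => /andP[xl _].
    have x0 : 0 < x by rewrite (lt_trans h0).
    rewrite derive1E deriveM//; last by apply: derivable_powR; rewrite in_itv/= x0.
    rewrite derive_cst scaler0 add0r -derive1E powR_derive1 ?in_itv/= ?x0//.
    by rewrite /GRing.scale/= mulrA mulVf ?gt_eqF// mul1r.
have h0 : b / n.+2%:R @[n --> \oo] --> (0 : R).
  rewrite -[X in _ --> X](mulr0 b); apply: cvgM; first exact: cvg_cst.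
  have := @cvg_harmonic R; rewrite -cvg_shiftS.
  exact.
have cvg2 : (\int[mu]_(x in F n) (x `^ (s - 1))%:E)%E @[n --> \oo] --> (b `^ s / s)%:E.
  rewrite (_ : (fun n => _) = (fun n => (b `^ s / s - (`|b / n.+2%:R| `^ s / s))%:E)); last first.
    apply/funext => n; rewrite FE -EFinB ger0_norm//.
    by rewrite ltW//; case/andP: (bn n).
  apply: cvg_EFin; first by near=> n.
  rewrite -[X in _ --> X]subr0; apply: cvgB; first exact: cvg_cst.
  rewrite -(mul0r s^-1); apply: cvgM; last exact: cvg_cst.
  rewrite -[X in _ --> X](@powR0 R s) ?gt_eqF// -[X in _ --> X `^ _](@normr0 _ R).
  apply: (@cvg_comp _ _ _ (fun n : nat => b / n.+2%:R) (fun y : R => `|y| `^ s)); last first.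
    exact: continuous_powR_ge0.
  exact: h0.
apply: cvg_unique cvg2; first exact: ereal_hausdorff.
apply: cvg1.
- move=> n1 n2 n12; apply/subsetPset => x; rewrite /F/= !in_itv/= => /andP[xl ->].
  rewrite andbT (le_trans _ xl)// ler_pM2l// lef_pV2 ?posrE// ler_nat !ltnS//.
- by move=> i; exact: measurable_itv.
- by move=> i; apply/measurable_EFinP/measurable_funTS; exact: measurable_powR.
- by move=> i x _; rewrite lee_fin powR_ge0.
Unshelve. all: end_near. Qed.

End Base.

(** * Fractional integrals of polynomials and integration by parts *)

Section Frac.
Variable R : realType.
Notation mu := (@lebesgue_measure R).

Lemma poly_bounded (p : {poly R}) :
  exists2 B : R, 0 <= B & forall x : R, -1 <= x <= 1 -> `|p.[x]| <= B.
Proof.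
elim/poly_ind: p => [|p c [B B0 HB]].
  by exists 0 => // x _; rewrite horner0 normr0.
exists (B + `|c|) => [|x x1]; first by rewrite addr_ge0.
rewrite hornerMXaddC (le_trans (ler_normD _ _))// lerD2r normrM.
rewrite (le_trans (ler_wpM2l (normr_ge0 _) (_ : `|x| <= 1)))// ?mulr1 ?HB//.
by rewrite ler_norml.
Qed.

Lemma le_integrable_EFin (d : measure_display) (T : measurableType d)
    (m : {measure set T -> \bar R}) (D : set T) (f h : T -> R) (B : R) :
  measurable D -> measurable_fun D f -> m.-integrable D (EFin \o h) ->
  (forall x, D x -> `|f x| <= B * `|h x|) -> m.-integrable D (EFin \o f).
Proof.
move=> mD mf ih fh.
apply: (@le_integrable _ _ _ _ _ _ _ (fun x => B%:E * (EFin \o h) x)%E) => //.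
- exact/measurable_EFinP.
- by move=> x Dx /=; rewrite lee_fin (le_trans (fh _ Dx))// normrM ler_wpM2r// ler_norm.
- exact: integrableZl.
Qed.

Lemma measurable_restrict_EFin (D : set R) (f : R -> R) :
  measurable D -> measurable_fun D f -> measurable_fun [set: R] ((EFin \o f) \_ D).
Proof.
move=> mD mf; apply/(measurable_restrictT (EFin \o f)) => //.
exact/measurable_EFinP.
Qed.

Lemma integral_powR_lend (s a b : R) : 0 < s -> a <= b ->
  (\int[mu]_(y in `[a, b]) ((b - y) `^ (s - 1))%:E = ((b - a) `^ s / s)%:E)%E.
Proof.
move=> s0 ab; rewrite -integral_powR ?subr_ge0// integral_mkcond [RHS]integral_mkcond.
set f := (X in _ = (\int[mu]_x X x)%E).
have := @ge0_integral_affine R (-1) b f.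
rewrite normrN1 invr1 mul1e => <-.
- apply: eq_integral => x _; rewrite /f !patchE !mem_setE !in_itv/= mulN1r addrC.
  by rewrite (addrC (- x)) subr_ge0 andbC lerD2l lerN2.
- by rewrite oppr_eq0 oner_eq0.
- by apply: measurable_restrict_EFin => //; apply: measurable_funTS; exact: measurable_powR.
- by move=> x; apply: erestrict_ge0 => y _; rewrite lee_fin powR_ge0.
Qed.

Lemma integral_powR_rend (s a b : R) : 0 < s -> a <= b ->
  (\int[mu]_(y in `[a, b]) ((y - a) `^ (s - 1))%:E = ((b - a) `^ s / s)%:E)%E.
Proof.
move=> s0 ab; rewrite -integral_powR ?subr_ge0// integral_mkcond [RHS]integral_mkcond.
set f := (X in _ = (\int[mu]_x X x)%E).
have := @ge0_integral_affine R 1 (- a) f.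
rewrite normr1 invr1 mul1e => <-.
- apply: eq_integral => x _; rewrite /f !patchE !mem_setE !in_itv/= mul1r.
  by rewrite subr_ge0 lerD2r.
- by rewrite oner_eq0.
- by apply: measurable_restrict_EFin => //; apply: measurable_funTS; exact: measurable_powR.
- by move=> x; apply: erestrict_ge0 => y _; rewrite lee_fin powR_ge0.
Qed.

Lemma measurable_powR_affine (s a b : R) (D : set R) :
  measurable_fun D (fun y : R => (a * y + b) `^ s).
Proof.
apply: measurable_funTS; apply: (measurableT_comp (measurable_powR _)).
exact: measurable_affine.
Qed.

Lemma measurable_powRB (s b : R) (D : set R) :
  measurable_fun D (fun y : R => (b - y) `^ s).
Proof.
rewrite (_ : (fun y => _) = (fun y : R => (-1 * y + b) `^ s)).
  exact: measurable_powR_affine.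
by apply/funext => y; rewrite mulN1r addrC.
Qed.

Lemma measurable_powRD (s b : R) (D : set R) :
  measurable_fun D (fun y : R => (y + b) `^ s).
Proof.
rewrite (_ : (fun y => _) = (fun y : R => (1 * y + b) `^ s)).
  exact: measurable_powR_affine.
by apply/funext => y; rewrite mul1r.
Qed.

Lemma integrable_powR_lend (s a b : R) : 0 < s -> a <= b ->
  mu.-integrable `[a, b] (EFin \o (fun y => (b - y) `^ (s - 1))).
Proof.
move=> s0 ab; apply/integrableP; split; first by apply/measurable_EFinP; exact: measurable_powRB.
under eq_integral do rewrite /= ger0_norm ?powR_ge0//.
by rewrite integral_powR_lend// ltry.
Qed.

Lemma integrable_powR_rend (s a b : R) : 0 < s -> a <= b ->
  mu.-integrable `[a, b] (EFin \o (fun y => (y - a) `^ (s - 1))).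
Proof.
move=> s0 ab; apply/integrableP; split; first by apply/measurable_EFinP; exact: measurable_powRD.
under eq_integral do rewrite /= ger0_norm ?powR_ge0//.
by rewrite integral_powR_rend// ltry.
Qed.

Lemma integrable_lker (s x : R) (w : {poly R}) : 0 < s -> -1 <= x <= 1 ->
  mu.-integrable `[-1, x] (EFin \o (fun y => (x - y) `^ (s - 1) * w.[y])).
Proof.
move=> s0 /andP[x0 x1]; have [B B0 HB] := poly_bounded w.
apply: (@le_integrable_EFin _ _ mu _ _ (fun y => (x - y) `^ (s - 1)) B) => //; last 1 first.
- move=> y /=; rewrite in_itv/= => /andP[y0 y1].
  by rewrite normrM mulrC ler_wpM2r// HB// y0 (le_trans y1).
- by apply: measurable_funM; [exact: measurable_powRB|exact: measurable_poly].
- exact: integrable_powR_lend.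
Qed.

Lemma integrable_rker (s x : R) (w : {poly R}) : 0 < s -> -1 <= x <= 1 ->
  mu.-integrable `[x, 1] (EFin \o (fun y => (y - x) `^ (s - 1) * w.[y])).
Proof.
move=> s0 /andP[x0 x1]; have [B B0 HB] := poly_bounded w.
apply: (@le_integrable_EFin _ _ mu _ _ (fun y => (y - x) `^ (s - 1)) B) => //; last 1 first.
- move=> y /=; rewrite in_itv/= => /andP[y0 y1].
  by rewrite normrM mulrC ler_wpM2r// HB// y1 (le_trans x0).
- by apply: measurable_funM; [exact: measurable_powRD|exact: measurable_poly].
- exact: integrable_powR_rend.
Qed.

(* Induction on w, from y = x - (x - y): the term (x - y) raises the exponent s. *)
Lemma lfrac_poly (w : {poly R}) (s : R) : 0 < s -> exists q : {poly R},
  forall x : R, -1 <= x <= 1 ->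
  Rintegral mu `[-1, x] (fun y => (x - y) `^ (s - 1) * w.[y]) = (x + 1) `^ s * q.[x].
Proof.
elim/poly_ind: w s => [|w c IH] s s0.
  exists 0 => x x1; rewrite horner0 mulr0.
  by under eq_Rintegral do rewrite horner0 mulr0; rewrite Rintegral_cst// mul0r.
have [q1 Hq1] := IH s s0.
have s1 : 0 < s + 1 by rewrite addr_gt0.
have [q2 Hq2] := IH _ s1.
exists (q1 * 'X - q2 * ('X + 1) + (c / s)%:P) => x x1.
have /andP[xl xr] := x1.
pose f y := (x - y) `^ (s - 1) * w.[y].
pose g y := (x - y) `^ (s + 1 - 1) * w.[y].
pose h y := (x - y) `^ (s - 1).
transitivity (Rintegral mu `[-1, x] (fun y => (x * f y - g y) + c * h y)).
  apply: eq_Rintegral => y; rewrite inE/= in_itv/= => /andP[y0 y1].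
  rewrite hornerMXaddC /f /g /h addrK -(@mulr_powRB1 _ (x - y) s) ?subr_ge0//; ring.
have if_ := integrable_lker w s0 x1; have ig := integrable_lker w s1 x1.
have ih : mu.-integrable `[-1, x] (EFin \o h) by exact: integrable_powR_lend.
rewrite RintegralD//; last 2 first.
- exact: (integrableB _ (integrableZl _ x if_) ig).
- exact: (integrableZl _ c ih).
rewrite RintegralB//; last exact: (integrableZl _ x if_).
rewrite !RintegralZl// Hq1// Hq2//.
rewrite [X in _ + c * X]/Rintegral integral_powR_lend// opprK /=.
rewrite !(hornerD, hornerN, hornerM, hornerX, hornerC) -(@mulr_powRB1 _ (x + 1) (s + 1))//; last by rewrite -lerBlDr sub0r.
rewrite (_ : s + 1 - 1 = s) ?addrK//; ring.
Qed.

(** Mirror image of [lfrac_poly]: here y = x + (y - x), so the term of exponent s + 1 enters with a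
    plus sign and contributes the factor 1 - x. *)
Lemma rfrac_poly (w : {poly R}) (s : R) : 0 < s -> exists q : {poly R},
  forall x : R, -1 <= x <= 1 ->
  Rintegral mu `[x, 1] (fun y => (y - x) `^ (s - 1) * w.[y]) = (1 - x) `^ s * q.[x].
Proof.
elim/poly_ind: w s => [|w c IH] s s0.
  exists 0 => x x1; rewrite horner0 mulr0.
  by under eq_Rintegral do rewrite horner0 mulr0; rewrite Rintegral_cst// mul0r.
have [q1 Hq1] := IH s s0.
have s1 : 0 < s + 1 by rewrite addr_gt0.
have [q2 Hq2] := IH _ s1.
exists (q1 * 'X + q2 * (1 - 'X) + (c / s)%:P) => x x1.
have /andP[xl xr] := x1.
pose f y := (y - x) `^ (s - 1) * w.[y].
pose g y := (y - x) `^ (s + 1 - 1) * w.[y].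
pose h y := (y - x) `^ (s - 1).
transitivity (Rintegral mu `[x, 1] (fun y => (x * f y + g y) + c * h y)).
  apply: eq_Rintegral => y; rewrite inE/= in_itv/= => /andP[y0 y1].
  rewrite hornerMXaddC /f /g /h addrK -(@mulr_powRB1 _ (y - x) s) ?subr_ge0//; ring.
have if_ := integrable_rker w s0 x1; have ig := integrable_rker w s1 x1.
have ih : mu.-integrable `[x, 1] (EFin \o h) by exact: integrable_powR_rend.
rewrite RintegralD//; last 2 first.
- exact: (integrableD _ (integrableZl _ x if_) ig).
- exact: (integrableZl _ c ih).
rewrite RintegralD//; last exact: (integrableZl _ x if_).
rewrite !RintegralZl// Hq1// Hq2//.
rewrite [X in _ + c * X]/Rintegral integral_powR_rend//=.
rewrite !(hornerD, hornerN, hornerM, hornerX, hornerC) -(@mulr_powRB1 _ (1 - x) (s + 1))//; last by rewrite subr_ge0.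
rewrite (_ : s + 1 - 1 = s) ?addrK//; ring.
Qed.

Lemma integrable_lparts (s : R) (P : {poly R}) : 0 < s ->
  mu.-integrable `]-1, 1[ (EFin \o (fun x => (x + 1) `^ (s - 1) * P.[x])).
Proof.
move=> s0; have [B B0 HB] := poly_bounded P.
apply: (@le_integrable_EFin _ _ mu _ _ (fun y => (y + 1) `^ (s - 1)) B) => //; last 1 first.
- move=> y /=; rewrite in_itv/= => /andP[y0 y1].
  by rewrite normrM mulrC ler_wpM2r// HB// !ltW.
- by apply: measurable_funM; [exact: measurable_powRD|exact: measurable_poly].
- apply: (@integrableS _ (measurableTypeR R) R mu `[-1, 1]%classic) => //.
    by apply: subset_itvW.
  by have := @integrable_powR_rend s (-1) 1 s0; rewrite opprK; apply; lra.
Qed.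

Lemma integrable_rparts (s : R) (P : {poly R}) : 0 < s ->
  mu.-integrable `]-1, 1[ (EFin \o (fun x => (1 - x) `^ (s - 1) * P.[x])).
Proof.
move=> s0; have [B B0 HB] := poly_bounded P.
apply: (@le_integrable_EFin _ _ mu _ _ (fun y => (1 - y) `^ (s - 1)) B) => //; last 1 first.
- move=> y /=; rewrite in_itv/= => /andP[y0 y1].
  by rewrite normrM mulrC ler_wpM2r// HB// !ltW.
- by apply: measurable_funM; [exact: measurable_powRB|exact: measurable_poly].
- apply: (@integrableS _ (measurableTypeR R) R mu `[-1, 1]%classic) => //.
    by apply: subset_itvW.
  by apply: integrable_powR_lend => //; lra.
Qed.

(** Q is kept independent of P because after a product rule only one of the two factors is
    differentiated. *)
Lemma integrable_lparts_sum (s : R) (P Q : {poly R}) : 0 < s ->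
  mu.-integrable `]-1, 1[
    (EFin \o (fun x => s * ((x + 1) `^ (s - 1) * P.[x]) + (x + 1) `^ s * Q.[x])).
Proof.
move=> s0; have s1 : 0 < s + 1 by rewrite addr_gt0.
have iQ := integrable_lparts Q s1; rewrite addrK in iQ.
exact: (integrableD _ (integrableZl _ s (integrable_lparts P s0)) iQ).
Qed.

Lemma integrable_rparts_sum (s : R) (P Q : {poly R}) : 0 < s ->
  mu.-integrable `]-1, 1[
    (EFin \o (fun x => - s * ((1 - x) `^ (s - 1) * P.[x]) + (1 - x) `^ s * Q.[x])).
Proof.
move=> s0; have s1 : 0 < s + 1 by rewrite addr_gt0.
have iQ := integrable_rparts Q s1; rewrite addrK in iQ.
exact: (integrableD _ (integrableZl _ (- s) (integrable_rparts P s0)) iQ).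
Qed.

(* The integrand is the derivative of (x + 1)^s P, singular at -1 when s < 1;
   writing x = (x + 1) - 1 lets the induction on P avoid limits. *)
Lemma lparts (P : {poly R}) (s : R) : 0 < s ->
  Rintegral mu `]-1, 1[
    (fun x => s * ((x + 1) `^ (s - 1) * P.[x]) + (x + 1) `^ s * P^`().[x])
  = 2 `^ s * P.[1].
Proof.
elim/poly_ind: P s => [|P c IH] s s0.
  under eq_Rintegral do rewrite deriv0 !horner0 !mulr0 addr0.
  by rewrite Rintegral_cst// mul0r horner0 mulr0.
have s1 : 0 < s + 1 by rewrite addr_gt0.
pose f x := (s + 1) * ((x + 1) `^ (s + 1 - 1) * P.[x]) + (x + 1) `^ (s + 1) * P^`().[x].
pose g x := s * ((x + 1) `^ (s - 1) * P.[x]) + (x + 1) `^ s * P^`().[x].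
pose h x := s * (c * ((x + 1) `^ (s - 1))).
transitivity (Rintegral mu `]-1, 1[ (fun x => (f x - g x) + h x)).
  apply: eq_Rintegral => x; rewrite inE/= in_itv/= => /andP[x0 x1].
  have x2 : 0 <= x + 1 by lra.
  rewrite derivD derivM derivX derivC !(hornerD, hornerN, hornerM, hornerX, hornerC) /f /g /h addrK.
  rewrite -(@mulr_powRB1 _ (x + 1) s)// -(@mulr_powRB1 _ (x + 1) (s + 1))// addrK.
  rewrite -(@mulr_powRB1 _ (x + 1) s)//; ring.
have hE : h = (fun x => (s * c) * ((x + 1) `^ (s - 1))).
  by apply/funext => x; rewrite /h mulrA.
have ih : mu.-integrable `]-1, 1[ (EFin \o (fun x => (x + 1) `^ (s - 1))).
  have := integrable_lparts 1 s0; apply: eq_integrable => // x _ /=.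
  by rewrite hornerC mulr1.
rewrite RintegralD//; last 2 first.
- exact: (integrableB _ (integrable_lparts_sum _ _ s1) (integrable_lparts_sum _ _ s0)).
- by rewrite hE; exact: (integrableZl _ (s * c) ih).
rewrite RintegralB//; last 2 first.
- exact: integrable_lparts_sum.
- exact: integrable_lparts_sum.
rewrite !IH// hE RintegralZl//.
have -> : Rintegral mu `]-1, 1[ (fun x => (x + 1) `^ (s - 1)) = 2 `^ s / s.
  rewrite -(@Rintegral_itv_oo _ _ _ _ true false); last exact: measurable_powRD.
  have := @integral_powR_rend s (-1) 1 s0; rewrite opprK => H.
  by rewrite /Rintegral H//; lra.
rewrite !(hornerD, hornerN, hornerM, hornerX, hornerC) -(@mulr_powRB1 _ 2 (s + 1))// addrK.
have s00 : s != 0 by rewrite gt_eqF.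
by field.
Qed.

(** Same induction as [lparts], now with x = 1 - (1 - x); the roles of [f] and [g] are exchanged. *)
Lemma rparts (P : {poly R}) (s : R) : 0 < s ->
  Rintegral mu `]-1, 1[
    (fun x => - s * ((1 - x) `^ (s - 1) * P.[x]) + (1 - x) `^ s * P^`().[x])
  = - (2 `^ s * P.[-1]).
Proof.
elim/poly_ind: P s => [|P c IH] s s0.
  under eq_Rintegral do rewrite deriv0 !horner0 !mulr0 addr0.
  by rewrite Rintegral_cst// mul0r horner0 mulr0 oppr0.
have s1 : 0 < s + 1 by rewrite addr_gt0.
pose f x := - (s + 1) * ((1 - x) `^ (s + 1 - 1) * P.[x]) + (1 - x) `^ (s + 1) * P^`().[x].
pose g x := - s * ((1 - x) `^ (s - 1) * P.[x]) + (1 - x) `^ s * P^`().[x].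
pose h x := - s * (c * ((1 - x) `^ (s - 1))).
transitivity (Rintegral mu `]-1, 1[ (fun x => (g x - f x) + h x)).
  apply: eq_Rintegral => x; rewrite inE/= in_itv/= => /andP[x0 x1].
  have x2 : 0 <= 1 - x by lra.
  rewrite derivD derivM derivX derivC !(hornerD, hornerN, hornerM, hornerX, hornerC) /f /g /h addrK.
  rewrite -(@mulr_powRB1 _ (1 - x) s)// -(@mulr_powRB1 _ (1 - x) (s + 1))// addrK.
  rewrite -(@mulr_powRB1 _ (1 - x) s)//; ring.
have hE : h = (fun x => (- s * c) * ((1 - x) `^ (s - 1))).
  by apply/funext => x; rewrite /h mulrA.
have ih : mu.-integrable `]-1, 1[ (EFin \o (fun x => (1 - x) `^ (s - 1))).
  have := integrable_rparts 1 s0; apply: eq_integrable => // x _ /=.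
  by rewrite hornerC mulr1.
rewrite RintegralD//; last 2 first.
- exact: (integrableB _ (integrable_rparts_sum _ _ s0) (integrable_rparts_sum _ _ s1)).
- by rewrite hE; exact: (integrableZl _ (- s * c) ih).
rewrite RintegralB//; last 2 first.
- exact: integrable_rparts_sum.
- exact: integrable_rparts_sum.
rewrite !IH// hE RintegralZl//.
have -> : Rintegral mu `]-1, 1[ (fun x => (1 - x) `^ (s - 1)) = 2 `^ s / s.
  rewrite -(@Rintegral_itv_oo _ _ _ _ true false); last exact: measurable_powRB.
  have := @integral_powR_lend s (-1) 1 s0; rewrite opprK => H.
  by rewrite /Rintegral H//; lra.
rewrite !(hornerD, hornerN, hornerM, hornerX, hornerC) -(@mulr_powRB1 _ 2 (s + 1))// addrK.
have s00 : s != 0 by rewrite gt_eqF.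
by field.
Qed.

Lemma is_derive_lparts (s x : R) (Q : {poly R}) : -1 < x ->
  is_derive x 1 (fun y => (y + 1) `^ s * Q.[y])
    (s * ((x + 1) `^ (s - 1) * Q.[x]) + (x + 1) `^ s * Q^`().[x]).
Proof.
move=> x1; have x0 : 0 < x + 1 by lra.
have d1 : is_derive x 1 (fun y : R => (y + 1) `^ s) (s * (x + 1) `^ (s - 1)).
  have d2 := @is_derive1_powR R s (x + 1) x0.
  have := @is_derive1_comp R (fun z => z `^ s) (fun y : R => y + 1) x _ 1 d2.
  by rewrite mulr1; apply; apply: is_derive_eq; rewrite addr0.
have d3 := is_derive_poly Q x.
apply: is_derive_eq; rewrite /GRing.scale/=; ring.
Qed.

Lemma is_derive_rparts (s x : R) (Q : {poly R}) : x < 1 ->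
  is_derive x 1 (fun y => (1 - y) `^ s * Q.[y])
    (- s * ((1 - x) `^ (s - 1) * Q.[x]) + (1 - x) `^ s * Q^`().[x]).
Proof.
move=> x1; have x0 : 0 < 1 - x by lra.
have d1 : is_derive x 1 (fun y : R => (1 - y) `^ s) (- s * (1 - x) `^ (s - 1)).
  have d2 := @is_derive1_powR R s (1 - x) x0.
  have d4 : is_derive x 1 (fun y : R => 1 - y) (-1).
    have := is_deriveB (is_derive_cst (1 : R) x (1 : R)) (is_derive_id x (1 : R)).
    by rewrite sub0r.
  have := @is_derive1_comp R (fun z => z `^ s) (fun y : R => 1 - y) x _ (-1) d2 d4.
  by rewrite mulrN1 mulNr.
have d3 := is_derive_poly Q x.
apply: is_derive_eq; rewrite /GRing.scale/=; ring.
Qed.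

(** The product rule turns D' v + D v' into the integrands of [lparts] for Q1 v and of [rparts] for
    Q2 v. As s > 0, each singular power vanishes at its own endpoint, so D(1) involves only Q1 and
    D(-1) only Q2. *)
Lemma ip_derive1_parts (s : R) (D : R -> R) (Q1 Q2 v : {poly R}) : 0 < s ->
  (forall x, -1 <= x <= 1 -> D x = (x + 1) `^ s * Q1.[x] + (1 - x) `^ s * Q2.[x]) ->
  ip (derive1 D) (fun x => v.[x]) =
    D 1 * v.[1] - D (-1) * v.[-1] - ip D (fun x => v^`().[x]).
Proof.
move=> s0 DE; apply/eqP; rewrite eq_sym subr_eq eq_sym; apply/eqP.
have s1 : 0 < s + 1 by rewrite addr_gt0.
pose l P x := s * ((x + 1) `^ (s - 1) * P.[x]) + (x + 1) `^ s * P^`().[x].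
pose r P x := - s * ((1 - x) `^ (s - 1) * P.[x]) + (1 - x) `^ s * P^`().[x].
pose a x := (s * ((x + 1) `^ (s - 1) * (Q1 * v).[x]) + (x + 1) `^ s * (Q1^`() * v).[x])
  + (- s * ((1 - x) `^ (s - 1) * (Q2 * v).[x]) + (1 - x) `^ s * (Q2^`() * v).[x]).
(* The exponent s is written s + 1 - 1 so that the integrability lemmas apply at s + 1. *)
pose b x := (x + 1) `^ (s + 1 - 1) * (Q1 * v^`()).[x] + (1 - x) `^ (s + 1 - 1) * (Q2 * v^`()).[x].
have ia : mu.-integrable `]-1, 1[ (EFin \o a).
  exact: (integrableD _ (integrable_lparts_sum _ _ s0) (integrable_rparts_sum _ _ s0)).
have ib : mu.-integrable `]-1, 1[ (EFin \o b).
  exact: (integrableD _ (integrable_lparts _ s1) (integrable_rparts _ s1)).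
have -> : ip (derive1 D) (fun x => v.[x]) = Rintegral mu `]-1, 1[ a.
  apply: eq_Rintegral => x; rewrite inE/= in_itv/= => /andP[x0 x1].
  have -> : derive1 D x = l Q1 x + r Q2 x.
    (* The formula for D is known on [-1, 1] only; at an interior point it holds in a neighbourhood,
       which is all that the derivative sees. *)
    rewrite derive1E (@near_eq_derive _ _ _ D
      (fun x : R => (x + 1) `^ s * Q1.[x] + (1 - x) `^ s * Q2.[x])); last first.
      near=> y; apply: DE; apply/andP; split.
        by apply: ltW; near: y; exact: lt_nbhsr.
      by apply: ltW; near: y; exact: lt_nbhsl.
    have d1 := @is_derive_lparts s x Q1 x0; have d2 := @is_derive_rparts s x Q2 x1.
    by rewrite derive_val.
  rewrite /a /l /r !hornerM; ring.
have -> : ip D (fun x => v^`().[x]) = Rintegral mu `]-1, 1[ b.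
  apply: eq_Rintegral => x; rewrite inE/= in_itv/= => /andP[x0 x1].
  by rewrite DE ?ltW// /b addrK !hornerM; ring.
rewrite -RintegralD//.
transitivity (Rintegral mu `]-1, 1[ (fun x => l (Q1 * v) x + r (Q2 * v) x)).
  apply: eq_Rintegral => x _; rewrite /a /b /l /r !derivM !(hornerD, hornerN, hornerM, hornerX, hornerC) !addrK; ring.
rewrite RintegralD//; last 2 first.
- exact: integrable_lparts_sum.
- exact: integrable_rparts_sum.
rewrite lparts// rparts// !DE ?lexx ?andbT; [|lra|lra].
rewrite subrr addNr opprK powR0 ?gt_eqF// !hornerM.
rewrite (_ : 1 + 1 = 2 :> R)//; ring.
Unshelve. all: end_near. Qed.

End Frac.

(** * Legendre polynomials *)

Section Legendre.
Variable R : realType.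
Notation mu := (@lebesgue_measure R).

Definition polyint (p : {poly R}) : R := Rintegral mu `]-1, 1[ (fun x => p.[x]).

Lemma integrable_poly (p : {poly R}) :
  mu.-integrable `]-1, 1[ (EFin \o (fun x => p.[x])).
Proof.
have [B B0 HB] := poly_bounded p.
apply: (@le_integrable_EFin _ _ _ mu _ _ (fun y => (y + 1) `^ (1 - 1) * (1 : {poly R}).[y]) B) => //; last 1 first.
- move=> y /=; rewrite in_itv/= => /andP[y0 y1].
  by rewrite subrr powRr0 hornerC !mul1r normr1 mulr1 HB// !ltW.
- exact: measurable_poly.
- exact: integrable_lparts.
Qed.

Lemma polyintD (p q : {poly R}) : polyint (p + q) = polyint p + polyint q.
Proof.
rewrite /polyint -RintegralD//; try exact: integrable_poly.
by apply: eq_Rintegral => x _; rewrite hornerD.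
Qed.

Lemma polyintZ (c : R) (p : {poly R}) : polyint (c *: p) = c * polyint p.
Proof.
rewrite /polyint -RintegralZl//; try exact: integrable_poly.
by apply: eq_Rintegral => x _; rewrite hornerZ.
Qed.

Lemma polyint0 : polyint 0 = 0.
Proof. by rewrite -(scale0r 0) polyintZ mul0r. Qed.

Lemma polyint_sum (I : Type) (r : seq I) (F : I -> {poly R}) :
  polyint (\sum_(i <- r) F i) = \sum_(i <- r) polyint (F i).
Proof.
elim: r => [|i r IH]; first by rewrite !big_nil polyint0.
by rewrite !big_cons polyintD IH.
Qed.

Lemma polyintB (p q : {poly R}) : polyint (p - q) = polyint p - polyint q.
Proof. by rewrite -scaleN1r polyintD polyintZ mulN1r. Qed.

(** The derivatives of (x+1) p and (1-x) p add up to 2 p', so this is half the sum of [lparts] and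
    [rparts] at s = 1. *)
Lemma polyint_deriv (p : {poly R}) : polyint p^`() = p.[1] - p.[-1].
Proof.
have h1 := @lparts R p 1 ltr01; have h2 := @rparts R p 1 ltr01.
have i1 := @integrable_lparts_sum R 1 p p^`() ltr01.
have i2 := @integrable_rparts_sum R 1 p p^`() ltr01.
have : polyint (2 *: p^`()) = 2 * p.[1] - 2 * p.[-1].
  rewrite powRr1// in h1 h2; rewrite -h1 -h2 -RintegralD; [|by []|exact: i1|exact: i2].
  apply: eq_Rintegral => x; rewrite inE/= in_itv/= => /andP[x0 x1].
  have xa : 0 <= x + 1 by rewrite -lerBlDr sub0r ltW.
  have xb : 0 <= 1 - x by rewrite subr_ge0 ltW.
  rewrite subrr !powRr0 !powRr1//.
  rewrite hornerZ; ring.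
rewrite polyintZ -mulrBr; apply: mulfI; by rewrite pnatr_eq0.
Qed.

Lemma polyint_parts (p q : {poly R}) :
  polyint (p^`() * q) = p.[1] * q.[1] - p.[-1] * q.[-1] - polyint (p * q^`()).
Proof.
have := polyint_deriv (p * q); rewrite derivM polyintD !hornerM => <-.
by rewrite addrK.
Qed.

Let qk k : {poly R} := ('X ^+ 2 - 1) ^+ k.

(** Each differentiation removes at most one factor X^2 - 1. Hence derivatives of order below k
    vanish at both endpoints, which kills all boundary terms in the Rodrigues formula. *)
Lemma derivn_qk k j : (j <= k)%N -> exists r, (qk k)^`(j) = ('X ^+ 2 - 1) ^+ (k - j) * r.
Proof.
elim: j => [|j IH] jk; first by exists 1; rewrite derivn0 subn0 mulr1.
have [r Hr] := IH (ltnW jk).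
rewrite -(subnSK jk) in Hr.
exists (('X ^+ 2 - 1)^`() *+ (k - j.+1).+1 * r + ('X ^+ 2 - 1) * r^`()).
rewrite derivnS Hr; move: ('X ^+ 2 - 1) => p.
rewrite derivM deriv_exp /= mulrDr [p ^+ _ * (p * _)]mulrA -exprSr; congr (_ + _).
by rewrite !mulrnAl mulrnAr mulrA [p^`() * _]mulrC.
Qed.

Lemma derivn_qk_root k j : (j < k)%N -> (qk k)^`(j).[1] = 0 /\ (qk k)^`(j).[-1] = 0.
Proof.
move=> jk; have [r ->] := derivn_qk (ltnW jk).
have k0 : (0 < k - j)%N by rewrite subn_gt0.
rewrite !hornerM !horner_exp !(hornerD, hornerN, horner_exp, hornerX, hornerC).
by rewrite sqrrN expr1n subrr expr0n gtn_eqF// !mul0r.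
Qed.

Lemma rodrigues_parts k j (g : {poly R}) : (j <= k)%N ->
  polyint ((qk k)^`(k) * g) = (-1) ^+ j * polyint ((qk k)^`(k - j) * g^`(j)).
Proof.
elim: j => [|j IH] jk; first by rewrite expr0 mul1r subn0 derivn0.
rewrite IH ?(ltnW jk)// -(subnSK jk) derivnS polyint_parts.
(* [rev_ord_proof] serves only as a proof of k - j.+1 < k. *)
have [-> ->] := @derivn_qk_root k (k - j.+1) (rev_ord_proof (Ordinal jk)).
by rewrite !mul0r subrr sub0r exprS -derivnS; ring.
Qed.

Lemma rodrigues k (g : {poly R}) :
  polyint ((qk k)^`(k) * g) = (-1) ^+ k * polyint (qk k * g^`(k)).
Proof. by rewrite (rodrigues_parts g (leqnn k)) subnn derivn0. Qed.

Lemma monic_q1 : ('X ^+ 2 - 1 : {poly R}) \is monic.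
Proof. by rewrite -[1]/(1%:P); exact: monicXnsubC. Qed.

Lemma size_q1 : size ('X ^+ 2 - 1 : {poly R}) = 3.
Proof. by rewrite -[1]/(1%:P) size_XnsubC. Qed.

Lemma monic_qk k : qk k \is monic.
Proof. exact: monic_exp monic_q1. Qed.

Lemma size_qk k : size (qk k) = (k.*2).+1.
Proof.
have := size_exp ('X ^+ 2 - 1 : {poly R}) k; rewrite size_q1/= => h.
have : (0 < size (qk k))%N by rewrite size_poly_gt0 monic_neq0// monic_qk.
by rewrite /qk; move: h; case: (size _) => //= m -> _; rewrite mulnC muln2.
Qed.

Lemma qk_top k : (qk k)`_(k.*2) = 1.
Proof. by have /monicP := monic_qk k; rewrite /lead_coef size_qk. Qed.

Let ck k : R := (2 ^+ k * (k`!)%:R)^-1.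

Lemma legendreE k : legendre R k = ck k *: (qk k)^`(k).
Proof. by []. Qed.

Lemma ck_neq0 k : ck k != 0.
Proof.
by rewrite invr_eq0 mulf_neq0// ?expf_neq0// pnatr_eq0// -lt0n fact_gt0.
Qed.

Lemma size_legendre k : (size (legendre R k) <= k.+1)%N.
Proof.
apply/leq_sizeP => j kj; rewrite legendreE coefZ coef_derivn nth_default ?mul0rn ?mulr0//.
by rewrite size_qk -addnn ltn_add2l.
Qed.

Lemma legendre_top k : (legendre R k)`_k != 0.
Proof.
rewrite legendreE coefZ mulf_neq0 ?ck_neq0// coef_derivn addnn qk_top.
by rewrite pnatr_eq0 -lt0n ffact_gt0 -addnn leq_addr.
Qed.

(** The size bound means degree less than k, so the k derivatives moved onto g annihilate it. *)
Lemma polyint_legendre_orth k (g : {poly R}) : (size g <= k)%N ->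
  polyint (legendre R k * g) = 0.
Proof.
move=> sg; rewrite legendreE -scalerAl polyintZ rodrigues derivn_poly0//.
by rewrite mulr0 polyint0 !mulr0.
Qed.

(** Wallis-type integrals, to which the squared norm of a Legendre polynomial reduces. *)
Let W k := polyint ((1 - 'X ^+ 2) ^+ k).

Lemma W0 : W 0 = 2.
Proof.
rewrite /W expr0; have -> : (1 : {poly R}) = ('X)^`() by rewrite derivX.
by rewrite polyint_deriv !hornerX; lra.
Qed.

(** Integrate the derivative of x (1 - x^2)^(k+1), which vanishes at both endpoints, and replace x^2
    by 1 - (1 - x^2). *)
Lemma WS k : (2 * k%:R + 3) * W k.+1 = (2 * k%:R + 2) * W k.
Proof.
have := polyint_deriv ('X * (1 - 'X ^+ 2) ^+ k.+1).
rewrite !hornerM !horner_exp !(hornerD, hornerN, horner_exp, hornerX, hornerC).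
rewrite sqrrN expr1n subrr expr0n/= !mulr0 subrr.
have -> : ('X * (1 - 'X ^+ 2) ^+ k.+1)^`() =
  (2 * k%:R + 3) *: (1 - 'X ^+ 2) ^+ k.+1 - (2 * k%:R + 2) *: (1 - 'X ^+ 2) ^+ k :> {poly R}.
  rewrite derivM derivX deriv_exp; rewrite derivD derivN derivXn derivC.
  rewrite exprS -!mul_polyC !polyCD !polyCM !polyC_natr /= -mulr_natr -natr1.
  move: (_ ^+ k) (k%:R) => P c; ring.
by rewrite polyintB !polyintZ => /eqP; rewrite subr_eq0 => /eqP.
Qed.

Lemma fact_double k : ((k.+1).*2)`! = ((k.*2).+2 * (k.*2).+1 * (k.*2)`!)%N.
Proof. by rewrite doubleS !factS mulnA. Qed.

(** The left side is what Rodrigues' formula gives for the squared norm of L_k. Both sides equal 2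
    at k = 0 and are multiplied by (2k+1)/(2k+3) when k increases by 1. *)
Lemma gamma00_qk k : ck k ^+ 2 * (k.*2)`!%:R * W k = gamma00 R k.
Proof.
elim: k => [|k IH].
  by rewrite W0 /ck /gamma00 expr0 double0 fact0; field.
have k0 : (0 : R) <= k%:R by exact: ler0n.
have h3 : 2 * k%:R + 3 != 0 :> R by rewrite gt_eqF//; lra.
have h1 : 2 * k%:R + 1 != 0 :> R by rewrite gt_eqF//; lra.
have h2 : k%:R + 1 != 0 :> R by rewrite gt_eqF//; lra.
have -> : W k.+1 = (2 * k%:R + 2) / (2 * k%:R + 3) * W k.
  by apply: (mulfI h3); rewrite WS mulrA mulrCA divff// mulr1.
have -> : ck k.+1 = ck k / (2 * (k%:R + 1)).
  rewrite /ck exprS factS natrM -natr1 -invfM; congr (_^-1); ring.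
have -> : ((k.+1).*2)`!%:R = (2 * k%:R + 2) * (2 * k%:R + 1) * (k.*2)`!%:R :> R.
  rewrite fact_double !natrM -[(k.*2).+2]addn2 -[(k.*2).+1]addn1 !natrD -muln2 natrM; ring.
transitivity ((2 * k%:R + 1) / (2 * k%:R + 3) * gamma00 R k); last first.
  by rewrite /gamma00 -natr1; field; repeat (apply/andP; split); rewrite gt_eqF//; lra.
rewrite -IH; field; repeat (apply/andP; split); rewrite gt_eqF//; lra.
Qed.

Lemma polyint_legendre_sqr k : polyint (legendre R k * legendre R k) = gamma00 R k.
Proof.
rewrite {1}legendreE -scalerAl polyintZ rodrigues legendreE derivnZ.
have -> : (qk k)^`(k)^`(k) = ((k.*2)`!%:R)%:P.
  apply/polyP => i; rewrite !coef_derivn coefC addnA addnn.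
  case: i => [|i]; last by rewrite nth_default ?mul0rn// size_qk addnS ltnS leq_addr.
  rewrite !addn0 qk_top ffactnn -mulrnA.
  by rewrite -(@ffact_fact k.*2 k) -addnn ?leq_addr// addnK.
have -> : qk k * (ck k *: ((k.*2)`!%:R)%:P) = (ck k * (k.*2)`!%:R) *: qk k.
  by rewrite -scalerAr mulrC mul_polyC scalerA.
rewrite polyintZ -gamma00_qk /W.
have -> : ((1 - 'X ^+ 2) ^+ k : {poly R}) = (-1) ^+ k *: qk k.
  by rewrite /qk -exprZn scaleN1r opprB.
by rewrite !polyintZ; ring.
Qed.

(** Subtracting the multiple of the top Legendre polynomial that cancels the leading coefficient
    lowers the size. Orthogonality identifies that multiple as the projection coefficient and shows
    that the lower coefficients are unaffected. *)
Lemma legendre_expand N (v : {poly R}) : (size v <= N)%N ->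
  v = \sum_(0 <= k < N) ((gamma00 R k)^-1 * polyint (legendre R k * v)) *: legendre R k.
Proof.
elim: N v => [|N IH] v sv.
  by rewrite big_geq//; apply/eqP; rewrite -size_poly_eq0 -leqn0.
pose a := v`_N / (legendre R N)`_N.
pose v' := v - a *: legendre R N.
have sv' : (size v' <= N)%N.
  apply/leq_sizeP => j Nj; rewrite coefB coefZ.
  move: Nj; rewrite leq_eqVlt => /predU1P[<-|Nj].
    by rewrite /a divfK ?legendre_top// subrr.
  have /leq_sizeP -> // := sv; have /leq_sizeP -> // := size_legendre N.
  by rewrite mulr0 subr0.
have vE : v = v' + a *: legendre R N by rewrite subrK.
clearbody v' a.
have g0 : gamma00 R N != 0.
  by rewrite /gamma00 mulf_neq0// invr_eq0 gt_eqF// ltr_wpDl// mulr_ge0.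
rewrite big_nat_recr//= {3}vE mulrDr polyintD polyint_legendre_orth// add0r.
rewrite -scalerAr polyintZ polyint_legendre_sqr mulrCA mulVf// mulr1.
rewrite {1}vE; congr (_ + _).
rewrite {1}(IH _ sv'); apply: eq_big_nat => k /andP[_ kN].
congr (_ *: _); congr (_ * _).
rewrite vE mulrDr polyintD -scalerAr polyintZ (mulrC (legendre R k) (legendre R N)).
by rewrite (@polyint_legendre_orth N (legendre R k)) ?mulr0 ?addr0//; exact: leq_trans (size_legendre _) kN.
Qed.

Lemma ip_legendre_kernel N (e : R) (v : {poly R}) : (size v <= N.+1)%N ->
  ip (fun x => \sum_(0 <= k < N.+1) (gamma00 R k)^-1 * (legendre R k).[x] * (legendre R k).[e])
     (fun x => v.[x]) = v.[e].
Proof.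
move=> sv; rewrite [in RHS](legendre_expand sv) horner_sum.
under [RHS]eq_bigr do rewrite hornerZ.
rewrite -[LHS]/(Rintegral _ _ _).
transitivity (polyint (\sum_(0 <= k < N.+1)
  ((gamma00 R k)^-1 * (legendre R k).[e]) *: (legendre R k * v))).
  apply: eq_Rintegral => x _; rewrite horner_sum mulr_suml.
  by apply: eq_bigr => k _; move: (legendre R k) => L; rewrite hornerZ hornerM; ring.
rewrite polyint_sum; apply: eq_bigr => k _; rewrite polyintZ; ring.
Qed.

(** No regularity of Q is given. If rho = 0, then K vanishes at every point and both sides are 0
    whatever the integral of Q; otherwise Q is itself the polynomial rho^-1 K. *)
Lemma ip_penalty (rho : R) (Q : R -> R) (K v : {poly R}) :
  (forall x, rho * Q x = K.[x]) ->
  rho * ip Q (fun x => v.[x]) = ip (fun x => K.[x]) (fun x => v.[x]).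
Proof.
move=> QK; have [r0|r0] := eqVneq rho 0.
  rewrite r0 mul0r; apply/esym; transitivity (polyint 0); last exact: polyint0.
  by apply: eq_Rintegral => x _; rewrite -QK r0 !mul0r horner0.
rewrite /ip.
have -> : Q = (fun x => (rho^-1 *: K).[x]).
  by apply/funext => x; rewrite hornerZ -QK mulKf.
rewrite -[X in rho * X]/(Rintegral _ _ _).
have E p : Rintegral mu `]-1, 1[ (fun x => p.[x] * v.[x]) = polyint (p * v).
  by apply: eq_Rintegral => x _; rewrite hornerM.
by rewrite !E -scalerAl polyintZ mulrA divff// mul1r.
Qed.

Lemma ip_legendre_penalty N (e rho : R) (Q : R -> R) (v : {poly R}) : (size v <= N.+1)%N ->
  (forall x : R, rho * Q x =
     \sum_(0 <= k < N.+1) (gamma00 R k)^-1 * (legendre R k).[x] * (legendre R k).[e]) ->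
  rho * ip Q (fun x => v.[x]) = v.[e].
Proof.
move=> sv QK; rewrite -(ip_legendre_kernel e sv).
rewrite (@ip_penalty _ _ (\sum_(0 <= k < N.+1) ((gamma00 R k)^-1 * (legendre R k).[e]) *: legendre R k)).
- congr (ip _ _); apply/funext => x; rewrite horner_sum; apply: eq_bigr => k _.
  by move: (legendre R k) => L; rewrite hornerZ mulrAC.
- move=> x; rewrite QK horner_sum; apply: eq_bigr => k _.
  by move: (legendre R k) => L; rewrite hornerZ mulrAC.
Qed.

End Legendre.

(** * Gamma and Cauchy kernels *)

Section Kernels.
Variable R : realType.
Notation mu := (@lebesgue_measure R).

(* The indicator is needed because powR is 1 on negative bases. *)
Definition ppow (a t : R) : R := \1_(`]0, +oo[%classic) t * t `^ a.

Lemma ppow_gt0 (a t : R) : 0 < t -> ppow a t = t `^ a.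
Proof. by move=> t0; rewrite /ppow indicE mem_set ?mul1r//= in_itv/= t0. Qed.

Lemma ppow_le0 (a t : R) : t <= 0 -> ppow a t = 0.
Proof.
move=> t0; rewrite /ppow indicE memNset ?mul0r//= in_itv/= andbT.
by apply/negP; rewrite -leNgt.
Qed.

Lemma ppow_ge0 (a t : R) : 0 <= ppow a t.
Proof. by rewrite /ppow mulr_ge0// ?powR_ge0// indicE ler0n. Qed.

Lemma measurable_ppow (a : R) : measurable_fun [set: R] (ppow a).
Proof.
apply: measurable_funM; last exact: measurable_powR.
by apply: measurable_indic; exact: measurable_itv.
Qed.

(** On nonnegative numbers the inverse is the power -1, including at 0, where both are 0 by
    convention. *)
Lemma measurable_inv_nneg (d : measure_display) (T : measurableType d) (f : T -> R) :
  (forall x, 0 <= f x) -> measurable_fun [set: T] f ->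
  measurable_fun [set: T] (fun x => (f x)^-1).
Proof.
move=> f0 mf; rewrite (_ : (fun x => _) = (fun x => (f x) `^ (-1))); last first.
  by apply/funext => x; rewrite powR_inv1.
exact: (measurableT_comp (measurable_powR _)).
Qed.

(** The interval [1, 2] has length 1 and stays away from the singularity at 0, so c itself bounds
    the integral from below. *)
Lemma ge0_integral_gt0 (f : R -> R) (c : R) : 0 < c -> measurable_fun [set: R] f ->
  (forall t, 0 <= f t) -> (forall t, 1 <= t <= 2 -> c <= f t) ->
  (0 < \int[mu]_t (f t)%:E)%E.
Proof.
move=> c0 mf f0 fc.
apply: (@lt_le_trans _ _ (\int[mu]_(t in `[1%R, 2%R]) c%:E)%E).
  rewrite integral_cst; last exact: measurable_itv.
  rewrite [X in (_ < _ * X)%E](_ : _ = mu `[1%R, 2%R]%classic)// lebesgue_measure_itv/=.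
  rewrite lte_fin ltr1n -EFinD -EFinM lte_fin mulr_gt0//.
apply: (@le_trans _ _ (\int[mu]_(t in `[1%R, 2%R]) (f t)%:E)%E).
  apply: ge0_le_integral.
  - exact: measurable_itv.
  - by move=> x _; rewrite lee_fin ltW.
  - exact: measurable_cst.
  - by apply/measurable_EFinP/measurable_funTS.
  - by move=> x /=; rewrite in_itv/= => x12; rewrite lee_fin fc.
apply: ge0_subset_integral => //.
- exact/measurable_EFinP.
- by move=> x _; rewrite lee_fin.
Qed.

Lemma integral_expRN : (\int[mu]_(x in `[0%R, +oo[) (expR (- x))%:E = 1%E)%E.
Proof.
rewrite (@ge0_continuous_FTC2y _ _ (fun x => - expR (- x)) 0 0).
- by rewrite oppr0 expR0 -EFinB opprK add0r.
- by move=> x _; exact: expR_ge0.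
- apply: continuous_subspaceT => x; apply: continuous_comp; last exact: continuous_expR.
  exact: continuousN.
- by rewrite -oppr0; apply: cvgN; exact: cvgr_expR.
- by move=> x _; apply: ex_derive.
- apply: cvg_at_right_filter; apply: cvgN.
  by apply: continuous_comp; [exact: continuousN|exact: continuous_expR].
- move=> x _; rewrite derive1E.
  by rewrite derive_val /GRing.scale/=; ring.
Qed.

Lemma cvg_powRN (a : R) : a < 0 -> x `^ a @[x --> +oo%R] --> (0 : R).
Proof.
move=> a0.
have h : (fun x : R => x^-1) x @[x --> +oo%R] --> (0 : R).
  apply/gtr0_cvgV0; last exact: cvg_id.
  exact: nbhs_pinfty_gt.
have h2 : `|x^-1| `^ (- a) @[x --> +oo%R] --> (0 : R).
  rewrite -[X in _ --> X](@powR0 R (- a)); last by rewrite gt_eqF// oppr_gt0.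
  rewrite -[X in _ --> X `^ _](@normr0 _ R).
  apply: (@cvg_comp _ _ _ (fun x : R => x^-1) (fun y : R => `|y| `^ (- a))); first exact: h.
  by apply: continuous_powR_ge0; rewrite oppr_gt0.
apply: cvg_trans h2; apply: near_eq_cvg; near=> x.
have x0 : 0 < x by near: x; exact: nbhs_pinfty_gt.
by rewrite ger0_norm ?invr_ge0 ?ltW// -powR_inv1 ?ltW// -powRrM mulN1r opprK.
Unshelve. all: end_near. Qed.

Lemma integral_powR_y (a : R) : 0 < a ->
  (\int[mu]_(x in `[1%R, +oo[) (x `^ (- a - 1))%:E = a^-1%:E)%E.
Proof.
move=> a0.
rewrite (@ge0_continuous_FTC2y _ _ (fun x => - (x `^ (- a) / a)) 1 0).
- by rewrite powR1 -EFinB sub0r opprK mul1r.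
- by move=> x _; exact: powR_ge0.
- apply: continuous_in_subspaceT => x; rewrite inE/= in_itv/= andbT => x1.
  by apply: continuous_powR_gt0; exact: lt_le_trans x1.
- rewrite -[X in _ --> X]oppr0 -[X in _ --> - X](mul0r a^-1); apply: cvgN; apply: cvgM; last exact: cvg_cst.
  by apply: cvg_powRN; rewrite oppr_lt0.
- move=> x x1; apply: derivableN; apply: derivableM => //; apply: derivable_powR.
  by rewrite in_itv/= andbT (lt_trans ltr01).
- apply: cvg_at_right_filter; apply: cvgN; apply: cvgM; last exact: cvg_cst.
  exact: continuous_powR_gt0.
- move=> x; rewrite in_itv/= andbT => x1.
  have x0 : 0 < x by exact: lt_trans x1.
  have d1 := @is_derive1_powR R (- a) x x0.
  have d2 : is_derive x 1 (fun x => - (x `^ (- a) / a)) (x `^ (- a - 1)).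
    apply: is_derive_eq; rewrite /GRing.scale/=.
    have ane0 : a != 0 by rewrite gt_eqF.
    by field.
  by rewrite derive1E derive_val.
Qed.

Definition gamker (s t : R) : R := ppow (s - 1) t * expR (- t).
(** For t > 0 this is t^(s-1) times the Poisson kernel 2t / (t^2 + d^2) at d = 1, with the factor t
    absorbed into the power. *)
Definition cauker (s t : R) : R := ppow s t * 2 / (t ^+ 2 + 1).

Lemma measurable_expRN : measurable_fun [set: R] (fun t : R => expR (- t)).
Proof.
apply: continuous_measurable_fun => x.
by apply: continuous_comp; [exact: continuousN|exact: continuous_expR].
Qed.

Lemma measurable_gamker (s : R) : measurable_fun [set: R] (gamker s).
Proof.
apply: measurable_funM; first exact: measurable_ppow.
exact: measurable_expRN.
Qed.

Lemma measurable_cauker (s : R) : measurable_fun [set: R] (cauker s).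
Proof.
apply: measurable_funM; first by apply: measurable_funM => //; exact: measurable_ppow.
apply: measurable_inv_nneg; first by move=> x; rewrite addr_ge0// sqr_ge0.
by apply: measurable_funD => //; exact: measurable_funX.
Qed.

Lemma gamker_ge0 (s t : R) : 0 <= gamker s t.
Proof. by rewrite mulr_ge0 ?ppow_ge0 ?expR_ge0. Qed.

Lemma cauker_ge0 (s t : R) : 0 <= cauker s t.
Proof.
by apply: divr_ge0; [rewrite mulr_ge0// ppow_ge0|rewrite addr_ge0// sqr_ge0].
Qed.

(** Meant for integrands that need one bound near the singularity and another at infinity. The
    bounds are added, so A and B may overlap. *)
Lemma ge0_integral_split_fin (f : R -> R) (A B : set R) (h1 h2 : R -> R) :
  measurable A -> measurable B ->
  measurable_fun [set: R] f -> measurable_fun [set: R] h1 -> measurable_fun [set: R] h2 ->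
  (forall t, 0 <= f t) -> (forall t, 0 <= h1 t) -> (forall t, 0 <= h2 t) ->
  (forall t, f t <= h1 t * \1_A t + h2 t * \1_B t) ->
  (\int[mu]_(t in A) (h1 t)%:E < +oo)%E -> (\int[mu]_(t in B) (h2 t)%:E < +oo)%E ->
  (\int[mu]_t (f t)%:E < +oo)%E.
Proof.
move=> mA mB mf mh1 mh2 f0 h10 h20 fh i1 i2.
have E h (C : set R) : (\int[mu]_(t in C) (h t)%:E = \int[mu]_t (h t * \1_C t)%:E)%E.
  rewrite integral_mkcond; apply: eq_integral => t _; rewrite patchE indicE.
  by case: ifPn => _; rewrite ?mulr1 ?mulr0.
have m1 : measurable_fun [set: R] (fun t => h1 t * \1_A t).
  by apply: measurable_funM => //; exact: measurable_indic.
have m2 : measurable_fun [set: R] (fun t => h2 t * \1_B t).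
  by apply: measurable_funM => //; exact: measurable_indic.
apply: (@le_lt_trans _ _ (\int[mu]_t ((h1 t * \1_A t)%:E + (h2 t * \1_B t)%:E))%E).
  apply: ge0_le_integral => //.
  - by move=> x _; rewrite lee_fin.
  - exact/measurable_EFinP.
  - by apply: emeasurable_funD; exact/measurable_EFinP.
  - by move=> x _; rewrite -EFinD lee_fin.
rewrite ge0_integralD//.
- by rewrite -!E lte_add_pinfty.
- by move=> x _; rewrite lee_fin mulr_ge0// indicE ler0n.
- exact/measurable_EFinP.
- by move=> x _; rewrite lee_fin mulr_ge0// indicE ler0n.
- exact/measurable_EFinP.
Qed.

Lemma integral_gamker_lty (s : R) : 0 < s < 1 -> (\int[mu]_t (gamker s t)%:E < +oo)%E.
Proof.
move=> /andP[s0 s1]; apply: (@ge0_integral_split_fin _ `[0, 1]%classic `[0, +oo[%classic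
  (fun t => t `^ (s - 1)) (fun t => expR (- t))).
- exact: measurable_itv.
- exact: measurable_itv.
- exact: measurable_gamker.
- exact: measurable_powR.
- exact: measurable_expRN.
- exact: gamker_ge0.
- by move=> t; exact: powR_ge0.
- by move=> t; exact: expR_ge0.
- move=> t; rewrite /gamker; have [t0|t0] := leP t 0.
    by rewrite ppow_le0// mul0r addr_ge0// mulr_ge0 ?powR_ge0 ?expR_ge0// indicE ler0n.
  have h1 : t \in `[0, +oo[%classic by apply/mem_set; rewrite /= in_itv/= ltW.
  rewrite ppow_gt0// !indicE h1 mulr1.
  have [t1|t1] := leP t 1.
    rewrite mem_set/= ?mulr1; last by rewrite in_itv/= t1 ltW.
    rewrite (le_trans (ler_wpM2l (powR_ge0 _ _) (_ : _ <= 1)))// ?mulr1 ?lerDl ?expR_ge0//.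
    by rewrite -expR0 ler_expR oppr_le0 ltW.
  rewrite ler_wpDl ?mulr_ge0 ?powR_ge0 ?ler0n// ler_piMl ?expR_ge0//.
  by rewrite -[leRHS](powRr0 t) ler_powR ?(ltW t1)// subr_le0 ltW.
- by rewrite integral_powR// ltry.
- by rewrite integral_expRN ltry.
Qed.

Lemma integral_cauker_lty (s : R) : 0 < s < 1 -> (\int[mu]_t (cauker s t)%:E < +oo)%E.
Proof.
(* On [0, 1] the bounds t^s <= 1 and t^2 + 1 >= 1 give 2. Beyond 1, t^2 + 1 >= t^2 gives 2 t^(s-2),
   with s - 2 written in the form expected by [integral_powR_y]; its integral is finite because s <
   1. *)
move=> /andP[s0 s1]; apply: (@ge0_integral_split_fin _ `[0, 1]%classic `[1, +oo[%classic
  (fun t => 2) (fun t => 2 * t `^ (- (1 - s) - 1))).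
- exact: measurable_itv.
- exact: measurable_itv.
- exact: measurable_cauker.
- exact: measurable_cst.
- by apply: measurable_funM; [exact: measurable_cst|exact: measurable_powR].
- exact: cauker_ge0.
- by move=> t.
- by move=> t; rewrite mulr_ge0// powR_ge0.
- move=> t; rewrite /cauker; have [t0|t0] := leP t 0.
    by rewrite ppow_le0// !mul0r addr_ge0// !mulr_ge0// ?powR_ge0// indicE ler0n.
  have q0 : 0 < t ^+ 2 + 1 by rewrite addr_gt0// exprn_gt0.
  rewrite ppow_gt0// !indicE; have [t1|t1] := leP t 1.
    rewrite mem_set/= ?mulr1; last by rewrite in_itv/= t1 ltW.
    rewrite ler_wpDr ?mulr_ge0 ?powR_ge0 ?ler0n//.
    rewrite ler_pdivrMr// mulrC ler_pM2l//.
    apply: (@le_trans _ _ 1); last by rewrite lerDr sqr_ge0.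
    by rewrite -(powRr0 t) ger_powR ?t0// ltW.
  have h1 : t \in `[1, +oo[%classic by apply/mem_set; rewrite /= in_itv/= ltW.
  rewrite h1 mulr1 ler_wpDl ?mulr_ge0 ?ler0n//.
  rewrite (_ : - (1 - s) - 1 = s - 2%:R); last by ring.
  rewrite powRB; last by rewrite (gt_eqF t0) implybT.
  rewrite powR_mulrn ?(ltW t0)// mulrA [2 * _]mulrC.
  rewrite ler_pM2l ?mulr_gt0 ?powR_gt0// lef_pV2 ?posrE ?exprn_gt0//.
  by rewrite lerDl.
- rewrite integral_cst; last exact: measurable_itv.
  rewrite [X in (_ * X < _)%E](_ : _ = mu `[0%R, 1%R]%classic)// lebesgue_measure_itv/=.
  by rewrite lte_fin ltr01 -EFinD -EFinM ltry.
- under eq_integral do rewrite EFinM.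
  rewrite ge0_integralZl_EFin//.
  + by rewrite integral_powR_y ?subr_gt0// -EFinM ltry.
  + by move=> t _; rewrite lee_fin powR_ge0.
  + by apply/measurable_EFinP/measurable_funTS; exact: measurable_powR.
Qed.

Lemma integral_gamker_gt0 (s : R) : 0 < s -> (0 < \int[mu]_t (gamker s t)%:E)%E.
Proof.
(* On [1, 2], t^(s-1) >= t^-1 >= 1/2 and e^(-t) >= e^(-2). *)
move=> s0; apply: (@ge0_integral_gt0 _ (2^-1 * expR (- 2))).
- by rewrite mulr_gt0// expR_gt0.
- exact: measurable_gamker.
- exact: gamker_ge0.
- move=> t /andP[t1 t2]; have t0 : 0 < t by exact: lt_le_trans t1.
  rewrite /gamker ppow_gt0//; apply: ler_pM; rewrite ?expR_ge0 ?invr_ge0//.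
    apply: (@le_trans _ _ (t `^ (-1))); first by rewrite powR_inv1 ?(ltW t0)// lef_pV2 ?posrE.
    by rewrite ler_powR// lerDr ltW.
  by rewrite ler_expR lerN2.
Qed.

Lemma integral_cauker_gt0 (s : R) : 0 <= s -> (0 < \int[mu]_t (cauker s t)%:E)%E.
Proof.
(* On [1, 2], t^s >= 1 and t^2 + 1 <= 5. *)
move=> s0; apply: (@ge0_integral_gt0 _ (2 / 5)) => //.
- exact: measurable_cauker.
- exact: cauker_ge0.
- move=> t /andP[t1 t2]; have t0 : 0 < t by exact: lt_le_trans t1.
  rewrite /cauker ppow_gt0//.
  have p1 : 1 <= t `^ s by rewrite -(powRr0 t) ler_powR.
  have q1 : t ^+ 2 + 1 <= 5 by nra.
  apply: ler_pM => //; first by rewrite ler_peMl.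
  by rewrite lef_pV2// posrE// addr_gt0// exprn_gt0.
Qed.

Lemma GammaE (s : R) : Gamma s = fine (\int[mu]_t (gamker s t)%:E)%E.
Proof.
rewrite /Gamma /Rintegral integral_mkcond; congr fine; apply: eq_integral => t _.
rewrite patchE /gamker /ppow indicE.
by case: ifPn => _; rewrite ?mul1r ?mul0r.
Qed.

Lemma Gamma_gt0 (s : R) : 0 < s < 1 -> 0 < Gamma s.
Proof. by move=> /[dup] s01 /andP[s0 _]; rewrite GammaE fine_gt0// integral_gamker_gt0// integral_gamker_lty. Qed.

Lemma EFin_Gamma (s : R) : 0 < s < 1 -> (\int[mu]_t (gamker s t)%:E = (Gamma s)%:E)%E.
Proof.
move=> /[dup] s01 /andP[s0 _].
by rewrite GammaE fineK// ge0_fin_numE ?integral_gamker_lty// ltW// integral_gamker_gt0.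
Qed.

Lemma ge0_integral_scale (f g : R -> R) (a b : R) : 0 < a ->
  measurable_fun [set: R] f -> measurable_fun [set: R] g ->
  (forall t, 0 <= f t) -> (forall t, 0 <= g t) ->
  0 < b -> (forall t, f (a * t) = b * g t) ->
  (\int[mu]_t (g t)%:E = (a * b)^-1%:E * \int[mu]_t (f t)%:E)%E.
Proof.
move=> a0 mf mg f0 g0 b0 fg.
have H := @ge0_integral_affine R a 0 (EFin \o f) (lt0r_neq0 a0)
  ((measurable_EFinP _ _).2 mf) (fun t => f0 t).
rewrite gtr0_norm// in H.
have : (\int[mu]_t (b%:E * (g t)%:E) = a^-1%:E * \int[mu]_t (f t)%:E)%E.
  by rewrite -H; apply: eq_integral => t _; rewrite /= addr0 fg EFinM.
rewrite ge0_integralZl_EFin; [|by []|by move=> ? _; rewrite lee_fin|exact/measurable_EFinP|exact: ltW].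
move=> /(congr1 (fun z => b^-1%:E * z)%E).
by rewrite !muleA -!EFinM mulVf ?gt_eqF// mul1e invfM mulrC.
Qed.

Lemma integral_gamker_scaled (s x : R) : 0 < s < 1 -> x != 0 ->
  (\int[mu]_t (ppow (s - 1) t * expR (- (t * `|x|)))%:E = (Gamma s * `|x| `^ (- s))%:E)%E.
Proof.
move=> s01 x0; have nx0 : 0 < `|x| by rewrite normr_gt0.
rewrite (@ge0_integral_scale (gamker s) _ `|x| (`|x| `^ (s - 1)))//.
- rewrite EFin_Gamma// -EFinM mulrC; congr ((_ * _)%:E).
  rewrite mulr_powRB1 ?ltW//; last by case/andP: s01.
  by rewrite powRN.
- exact: measurable_gamker.
- apply: measurable_funM; first exact: measurable_ppow.
  apply: (measurableT_comp measurable_expRN); exact: measurable_funM.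
- exact: gamker_ge0.
- by move=> t; rewrite mulr_ge0 ?ppow_ge0 ?expR_ge0.
- exact: powR_gt0.
- move=> t; rewrite /gamker; have [t0|t0] := leP t 0.
    by rewrite !ppow_le0 ?mul0r ?mulr0// pmulr_rle0.
  by rewrite !ppow_gt0 ?mulr_gt0// powRM ?ltW// mulrA [t * _]mulrC.
Qed.

(** For 0 < s < 1 the value is pi / cos(pi s / 2); it enters the final constant through its
    positivity. *)
Definition cauconst (s : R) : R := fine (\int[mu]_t (cauker s t)%:E)%E.

Lemma cauconst_gt0 (s : R) : 0 < s < 1 -> 0 < cauconst s.
Proof.
by move=> /[dup] s01 /andP[s0 _]; rewrite /cauconst fine_gt0// integral_cauker_gt0 ?integral_cauker_lty// ltW.
Qed.

Lemma EFin_cauconst (s : R) : 0 < s < 1 -> (\int[mu]_t (cauker s t)%:E = (cauconst s)%:E)%E.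
Proof.
move=> /[dup] s01 /andP[s0 _].
by rewrite fineK// ge0_fin_numE ?integral_cauker_lty// ltW// integral_cauker_gt0// ltW.
Qed.

Lemma integral_cauker_scaled (s x : R) : 0 < s < 1 -> x != 0 ->
  (\int[mu]_t (ppow (s - 1) t * (2 * t / (t ^+ 2 + x ^+ 2)))%:E =
   (cauconst s * `|x| `^ (s - 1))%:E)%E.
Proof.
move=> s01 x0; have nx0 : 0 < `|x| by rewrite normr_gt0.
have nx2 : x ^+ 2 = `|x| ^+ 2 by rewrite real_normK// num_real.
have s0 : 0 < s by case/andP: s01.
rewrite nx2; set y : R := `|x|; have y0 : 0 < y := nx0; clearbody y; clear nx2 x0 nx0.
have E t : ppow (s - 1) t * (2 * t / (t ^+ 2 + y ^+ 2)) = ppow s t * 2 / (t ^+ 2 + y ^+ 2).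
  have [t0|t0] := leP t 0; first by rewrite !ppow_le0// !mul0r.
  rewrite !ppow_gt0// -(@mulr_powRB1 _ t s) ?ltW//; ring.
under eq_integral do rewrite E.
have mg : measurable_fun [set: R] (fun t => ppow s t * 2 / (t ^+ 2 + y ^+ 2)).
  apply: measurable_funM; first by apply: measurable_funM => //; exact: measurable_ppow.
  apply: measurable_inv_nneg; first by move=> t; rewrite addr_ge0// sqr_ge0.
  by apply: measurable_funD => //; exact: measurable_funX.
(* Replacing t by t / y in [cauker] pulls out y^(-s) from the power and y^2 from the denominator. *)
rewrite (@ge0_integral_scale (cauker s) _ y^-1 (y ^+ 2 / y `^ s))//.
- rewrite EFin_cauconst// -EFinM mulrC; congr ((_ * _)%:E).
  rewrite powRB ?powRr1 ?(ltW y0)//; last by rewrite (gt_eqF y0) implybT.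
  have p0 : y `^ s != 0 by rewrite gt_eqF// powR_gt0.
  by have y00 : y != 0 := lt0r_neq0 y0; field; rewrite p0 y00.
- by rewrite invr_gt0.
- exact: measurable_cauker.
- exact: cauker_ge0.
- by move=> t; apply: divr_ge0; [rewrite mulr_ge0// ppow_ge0|rewrite addr_ge0// sqr_ge0].
- by rewrite divr_gt0 ?powR_gt0 ?exprn_gt0.
- move=> t; rewrite /cauker; have [t0|t0] := leP t 0.
    by rewrite !ppow_le0 ?mul0r ?mulr0// pmulr_rle0 ?invr_gt0.
  rewrite !ppow_gt0 ?mulr_gt0 ?invr_gt0// powRM ?invr_ge0 ?ltW//.
  rewrite -powR_inv1 ?ltW// -powRrM mulN1r powRN powR_inv1 ?ltW//.
  have p0 : y `^ s != 0 by rewrite gt_eqF// powR_gt0.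
  have q0 : t ^+ 2 + y ^+ 2 != 0 by rewrite gt_eqF// addr_gt0// exprn_gt0.
  have y00 : y != 0 by rewrite gt_eqF.
  by field; rewrite p0 y00 /= q0.
Qed.

End Kernels.

(** * The Poisson kernel *)

Section Poisson.
Variable R : realType.
Notation mu := (@lebesgue_measure R).

Lemma cvg_expRNM (t : R) : 0 < t -> expR (- (t * x)) @[x --> +oo%R] --> (0 : R).
Proof.
move=> t0; apply: (@cvg_comp _ _ _ (fun x : R => t * x) (fun y => expR (- y))); last exact: cvgr_expR.
apply: gt0_cvgMry => //; exact: cvg_id.
Qed.

(* Adding 1 to the cosine keeps the integrand nonnegative, as the fundamental
   theorem of calculus on half-lines requires. *)
Lemma integral_exp_cos_half (t d : R) : 0 < t ->
  (\int[mu]_(x in `[0%R, +oo[) (expR (- (t * x)) * (1 + cos (x * d)))%:E =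
   (t^-1 + t / (t ^+ 2 + d ^+ 2))%:E)%E.
Proof.
move=> t0.
have tn0 : t != 0 by rewrite gt_eqF.
have q0 : 0 < t ^+ 2 + d ^+ 2 by rewrite ltr_pwDl ?exprn_gt0// sqr_ge0.
have qn0 : t ^+ 2 + d ^+ 2 != 0 by rewrite gt_eqF.
pose b x := - t^-1 + (d * sin (x * d) - t * cos (x * d)) / (t ^+ 2 + d ^+ 2).
pose F x := expR (- (t * x)) * b x.
have dF (x : R) : is_derive x (1 : R) F (expR (- (t * x)) * (1 + cos (x * d))).
  rewrite /F /b; apply: is_derive_eq.
  rewrite /GRing.scale/=; field; rewrite ?tn0 ?qn0//.
have cF : continuous F.
  move=> x; apply: differentiable_continuous; apply/derivable1_diffP.
  exact: ex_derive.
rewrite (@ge0_continuous_FTC2y _ _ F 0 0).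
- rewrite -EFinB sub0r /F /b !(mulr0, mul0r) oppr0 expR0 sin0 cos0; congr EFin.
  by field; rewrite tn0 qn0.
- move=> x _; rewrite mulr_ge0 ?expR_ge0// -lerBlDl sub0r; exact: cos_geN1.
- apply: continuous_subspaceT => x.
  apply: differentiable_continuous; apply/derivable1_diffP; exact: ex_derive.
- pose c := t^-1 + (`|d| + t) / (t ^+ 2 + d ^+ 2).
  have bc x : `|b x| <= c.
    rewrite /b /c (le_trans (ler_normD _ _))// normrN ger0_norm ?invr_ge0 ?(ltW t0)// lerD2l.
    rewrite normrM [X in _ * X]ger0_norm ?invr_ge0 ?(ltW q0)// ler_wpM2r ?invr_ge0 ?(ltW q0)//.
    rewrite (le_trans (ler_normB _ _))// !normrM lerD//.
      by rewrite ler_piMr// sin_max.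
    by rewrite ger0_norm ?(ltW t0)// ler_piMr ?(ltW t0)// cos_max.
  have e0 := cvg_expRNM t0.
  apply: (@squeeze_cvgr _ _ _ _ (fun x => - c * expR (- (t * x))) (fun x => c * expR (- (t * x)))).
  + near=> x; rewrite /F !(mulrC (expR _)).
    have := bc x; rewrite ler_norml => /andP[b1 b2].
    by rewrite !ler_wpM2r ?expR_ge0.
  + by rewrite -(mulr0 (- c)); apply: cvgM; [exact: cvg_cst|exact: e0].
  + by rewrite -(mulr0 c); apply: cvgM; [exact: cvg_cst|exact: e0].
- by move=> x _; apply: ex_derive.
- by apply: cvg_at_right_filter; exact: cF.
- by move=> x _; rewrite derive1E; apply: derive_val.
Unshelve. all: end_near. Qed.

Lemma continuous_expRN_norm (t : R) : continuous (fun x : R => expR (- (t * `|x|))).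
Proof.
move=> x; apply: (@continuous_comp _ _ _ (fun x : R => - (t * `|x|)) expR); last exact: continuous_expR.
apply: continuousN; apply: continuousM; first exact: cst_continuous.
exact: norm_continuous.
Qed.

Lemma continuous_cosM (d : R) : continuous (fun x : R => cos (x * d)).
Proof.
move=> x; apply: (@continuous_comp _ _ _ (fun x : R => x * d) cos); last exact: continuous_cos.
apply: continuousM; [exact: cvg_id|exact: cst_continuous].
Qed.

Lemma continuous_exp_cos (t d : R) :
  continuous (fun x : R => expR (- (t * `|x|)) * cos (x * d)).
Proof.
move=> x; apply: (@continuousM _ R^o (fun x : R => expR (- (t * `|x|))) (fun x : R => cos (x * d))).
  exact: continuous_expRN_norm.
exact: continuous_cosM.
Qed.

Lemma continuous_exp_cos1 (t d : R) :
  continuous (fun x : R => expR (- (t * `|x|)) * (1 + cos (x * d))).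
Proof.
move=> x; apply: (@continuousM _ R^o (fun x : R => expR (- (t * `|x|))) (fun x : R => 1 + cos (x * d))).
  exact: continuous_expRN_norm.
by apply: continuousD; [exact: cst_continuous|exact: continuous_cosM].
Qed.

Lemma integral_exp_cos_full (t d : R) : 0 < t ->
  (\int[mu]_x (expR (- (t * `|x|)) * (1 + cos (x * d)))%:E =
   (2 / t + 2 * t / (t ^+ 2 + d ^+ 2))%:E)%E.
Proof.
move=> t0.
rewrite (@ge0_symfun_integralT _ (fun x => expR (- (t * `|x|)) * (1 + cos (x * d)))).
- rewrite -set_itvcy.
  have -> : (\int[mu]_(x in `[0%R, +oo[) (expR (- (t * `|x|)) * (1 + cos (x * d)))%:E =
      \int[mu]_(x in `[0%R, +oo[) (expR (- (t * x)) * (1 + cos (x * d)))%:E)%E.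
    apply: eq_integral => x; rewrite inE/= in_itv/= andbT => x0.
    by rewrite ger0_norm.
  by rewrite integral_exp_cos_half// -EFinM; congr EFin; ring.
- move=> x; rewrite mulr_ge0 ?expR_ge0// -lerBlDl sub0r; exact: cos_geN1.
- exact: continuous_exp_cos1.
- by move=> x /=; rewrite normrN mulNr cosN.
Qed.

Lemma integrable_expRN_norm (t : R) : 0 < t ->
  mu.-integrable [set: R] (EFin \o (fun x => expR (- (t * `|x|)))).
Proof.
move=> t0; apply/integrableP; split.
  apply/measurable_EFinP; apply: continuous_measurable_fun.
  exact: continuous_expRN_norm.
(* At d = 0 the integrand already computed is twice the exponential. *)
apply: (@le_lt_trans _ _ (\int[mu]_x (expR (- (t * `|x|)) * (1 + cos (x * 0)))%:E)%E); last first.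
  by rewrite integral_exp_cos_full// ltry.
apply: ge0_le_integral => //.
- apply/measurable_EFinP; apply: measurableT_comp => //; apply: continuous_measurable_fun.
  exact: continuous_expRN_norm.
- apply/measurable_EFinP; apply: continuous_measurable_fun.
  exact: continuous_exp_cos1.
- move=> x _ /=; rewrite lee_fin ger0_norm ?expR_ge0// ler_peMr ?expR_ge0//.
  by rewrite mulr0 cos0 lerDr.
Qed.

Lemma integrable_exp_cos (t d : R) : 0 < t ->
  mu.-integrable [set: R] (EFin \o (fun x => expR (- (t * `|x|)) * cos (x * d))).
Proof.
move=> t0.
apply: (@le_integrable_EFin _ _ _ mu _ _ (fun x => expR (- (t * `|x|))) 1) => //.
- by apply: continuous_measurable_fun; exact: continuous_exp_cos.
- exact: integrable_expRN_norm.
- by move=> x _; rewrite mul1r normrM ler_piMr// cos_max.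
Qed.

(** Subtracts the auxiliary summand 1: its contribution, the integral of the exponential alone, is
    half of the formula at d = 0. *)
Lemma poisson_integral (t d : R) : 0 < t ->
  (\int[mu]_x (expR (- (t * `|x|)) * cos (x * d))%:E = (2 * t / (t ^+ 2 + d ^+ 2))%:E)%E.
Proof.
move=> t0; have H0 := @integral_exp_cos_full t 0 t0; have Hd := @integral_exp_cos_full t d t0.
have ie := integrable_expRN_norm t0; have ic := @integrable_exp_cos t d t0.
have E0 : (\int[mu]_x (expR (- (t * `|x|)))%:E = (2 / t)%:E)%E.
  have /fineK E : (\int[mu]_x (expR (- (t * `|x|)))%:E)%E \is a fin_num.
    exact: integrable_fin_num.
  have : (\int[mu]_x (2%:E * (expR (- (t * `|x|)))%:E) = (2 / t + 2 * t / (t ^+ 2 + 0 ^+ 2))%:E)%E.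
    rewrite -H0; apply: eq_integral => x _; rewrite mulr0 cos0 -EFinM; congr EFin; ring.
  rewrite integralZl// -E -EFinM => -[] H; congr EFin; clear -H t0.
  apply: (@mulfI _ 2); first by rewrite pnatr_eq0.
  by rewrite H; field; rewrite gt_eqF.
have : (\int[mu]_x ((expR (- (t * `|x|)))%:E + (expR (- (t * `|x|)) * cos (x * d))%:E) =
  (2 / t + 2 * t / (t ^+ 2 + d ^+ 2))%:E)%E.
  by rewrite -Hd; apply: eq_integral => x _; rewrite -EFinD mulrDr mulr1.
rewrite integralD//.
have /fineK <- : (\int[mu]_x (expR (- (t * `|x|)) * cos (x * d))%:E)%E \is a fin_num.
  exact: integrable_fin_num.
rewrite E0 -EFinD => -[] /addrI -> //.
Qed.

End Poisson.

(** * Integrals of tensor products *)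

Section Tensor.
Context (d1 d2 : measure_display) (T1 : measurableType d1) (T2 : measurableType d2) (R : realType).
Variables (m1 : {sigma_finite_measure set T1 -> \bar R}) (m2 : {sigma_finite_measure set T2 -> \bar R}).

Lemma measurable_tensor (a : T1 -> R) (b : T2 -> R) :
  measurable_fun [set: T1] a -> measurable_fun [set: T2] b ->
  measurable_fun [set: T1 * T2] (fun z => a z.1 * b z.2).
Proof.
by move=> ma mb; apply: measurable_funM;
  [exact: (measurableT_comp ma measurable_fst)|exact: (measurableT_comp mb measurable_snd)].
Qed.

Lemma integrable_tensor (a : T1 -> R) (b : T2 -> R) :
  m1.-integrable [set: T1] (EFin \o a) -> m2.-integrable [set: T2] (EFin \o b) ->
  (m1 \x m2)%E.-integrable [set: T1 * T2] (EFin \o (fun z => a z.1 * b z.2)).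
Proof.
move=> ia ib.
have ma : measurable_fun [set: T1] a by apply/measurable_EFinP; exact: measurable_int ia.
have mb : measurable_fun [set: T2] b by apply/measurable_EFinP; exact: measurable_int ib.
apply/integrable12ltyP; first by apply/measurable_EFinP; exact: measurable_tensor.
have /integrableP[_ la] := ia; have /integrableP[_ lb] := ib.
under eq_integral => x _.
  under eq_integral => y _ do rewrite /= normrM EFinM.
  rewrite ge0_integralZl_EFin//; last exact/measurable_EFinP/measurableT_comp.
  over.
rewrite /= ge0_integralZr//; last 2 first.
- exact/measurable_EFinP/measurableT_comp.
- exact: integral_ge0.
rewrite lte_mul_pinfty//.
- exact: integral_ge0.
- by rewrite ge0_fin_numE// integral_ge0.
Qed.

Lemma integral_tensor (a : T1 -> R) (b : T2 -> R) :
  m1.-integrable [set: T1] (EFin \o a) -> m2.-integrable [set: T2] (EFin \o b) ->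
  Rintegral (m1 \x m2)%E [set: T1 * T2] (fun z => a z.1 * b z.2) =
  Rintegral m1 [set: T1] a * Rintegral m2 [set: T2] b.
Proof.
move=> ia ib; rewrite /Rintegral -integral12_prod_meas1; last exact: integrable_tensor.
rewrite /fubini_F /=.
have fa := integrable_fin_num measurableT ia.
have fb := integrable_fin_num measurableT ib.
under eq_integral => x _.
  under eq_integral => y _ do rewrite /= EFinM.
  rewrite integralZl// -(fineK fb).
  over.
rewrite integralZr// -(fineK fa) //.
Qed.

End Tensor.

(** * Spectral representation of the Riesz energy *)

Section Spectral.
Context (d2 : measure_display) (T2 : measurableType d2) (R : realType).
Variable m2 : {sigma_finite_measure set T2 -> \bar R}.
Notation mu := (@lebesgue_measure R).
Notation T := (measurableTypeR R).
Variables (s : R) (G del : T2 -> R).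
Hypothesis s01 : 0 < s < 1.
Hypothesis iG : m2.-integrable [set: T2] (EFin \o G).
Hypothesis mdel : measurable_fun [set: T2] del.

Lemma measurable_cos : measurable_fun [set: R] (@cos R).
Proof. by apply: continuous_measurable_fun; exact: continuous_cos. Qed.

Lemma measurable_sin : measurable_fun [set: R] (@sin R).
Proof. by apply: continuous_measurable_fun; exact: continuous_sin. Qed.

Let mG : measurable_fun [set: T2] G.
Proof. by apply/measurable_EFinP; exact: measurable_int iG. Qed.

Lemma integrable_mul_bounded (b : T2 -> R) (c : R) :
  measurable_fun [set: T2] b -> (forall z, `|b z| <= c) ->
  m2.-integrable [set: T2] (EFin \o (fun z => G z * b z)).
Proof.
move=> mb bc; apply: (@le_integrable_EFin _ _ _ m2 _ _ G c) => //.
- exact: measurable_funM.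
- by move=> z _; rewrite normrM mulrC ler_wpM2r.
Qed.

(** For z = (x, y), G z = g(x) g(y) and del z = x - y, this is the squared modulus of the integral
    of g(x) e^(i xi x). Treating z as one variable of an abstract space leaves only exchanges of two
    variables. *)
Definition spectral (xi : R) : R := Rintegral m2 [set: T2] (fun z => G z * cos (xi * del z)).

(** The cosine is bounded by 1, so the tensor product of e^(-t|xi|) and G dominates; the damping
    supplies the decay in xi. *)
Lemma integrable_damped (t : R) : 0 < t -> (mu \x m2)%E.-integrable [set: T * T2]
  (EFin \o (fun p : T * T2 => expR (- (t * `|p.1 : R|)) * (G p.2 * cos (p.1 * del p.2)))).
Proof.
move=> t0.
have ie : mu.-integrable [set: T] (EFin \o (fun x : T => expR (- (t * `|x : R|)))).
  exact: integrable_expRN_norm.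
have it := integrable_tensor ie iG.
apply: (le_integrable_EFin (B := 1) _ _ it) => //.
- apply: measurable_funM.
    apply: (measurableT_comp (f := fun x : T => expR (- (t * `|x : R|)))).
      by apply/measurable_EFinP; exact: measurable_int ie.
    exact: measurable_fst.
  apply: measurable_funM; first exact: (measurableT_comp mG measurable_snd).
  apply: (measurableT_comp measurable_cos); apply: measurable_funM; first exact: measurable_fst.
  exact: (measurableT_comp mdel measurable_snd).
- by move=> p _; rewrite mul1r mulrA normrM ler_piMr// cos_max.
Qed.

Lemma integral_damped_inner (t xi : R) :
  (\int[m2]_z (expR (- (t * `|xi|)) * (G z * cos (xi * del z)))%:E =
   (expR (- (t * `|xi|)) * spectral xi)%:E)%E.
Proof.
have i : m2.-integrable [set: T2] (EFin \o (fun z => G z * cos (xi * del z))).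
  apply: (@integrable_mul_bounded _ 1); last by move=> z; exact: cos_max.
  by apply: (measurableT_comp measurable_cos); exact: measurable_funM.
under eq_integral => z _ do rewrite EFinM.
rewrite integralZl// EFinM; congr (_ * _)%E.
by rewrite fineK//; exact: integrable_fin_num.
Qed.

Lemma integrable_poisson (t : R) : 0 < t ->
  m2.-integrable [set: T2] (EFin \o (fun z => G z * (2 * t / (t ^+ 2 + del z ^+ 2)))).
Proof.
move=> t0; apply: (@integrable_mul_bounded _ (2 / t)).
  apply: measurable_funM => //; apply: measurable_inv_nneg.
    by move=> z; rewrite addr_ge0 ?sqr_ge0.
  by apply: measurable_funD => //; exact: measurable_funX.
move=> z; have q0 : 0 < t ^+ 2 + del z ^+ 2 by rewrite ltr_pwDl ?exprn_gt0// sqr_ge0.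
rewrite ger0_norm; last by rewrite divr_ge0// ?(ltW q0)// mulr_ge0 ?(ltW t0).
rewrite ler_pdivrMr// -mulrA ler_pM2l// mulrC ler_pdivlMr// -expr2.
by rewrite lerDl sqr_ge0.
Qed.

Lemma integral_damped (t : R) : 0 < t ->
  (\int[mu]_xi (expR (- (t * `|xi|)) * spectral xi)%:E =
   (Rintegral m2 [set: T2] (fun z => G z * (2 * t / (t ^+ 2 + del z ^+ 2))))%:E)%E.
Proof.
move=> t0; have F2 := Fubini (integrable_damped t0).
transitivity (\int[mu]_xi \int[m2]_z (expR (- (t * `|xi|)) * (G z * cos (xi * del z)))%:E)%E.
  by apply: eq_integral => xi _; rewrite integral_damped_inner.
rewrite [LHS]F2 /=.
rewrite /Rintegral fineK; last exact: (integrable_fin_num measurableT (integrable_poisson t0)).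
apply: eq_integral => z _.
under eq_integral => xi _ do rewrite mulrCA EFinM.
rewrite integralZl//; last exact: integrable_exp_cos.
by rewrite poisson_integral// -EFinM.
Qed.

(* Fubini gives measurability only after damping by exp(-|xi|). *)
Lemma measurable_spectral : measurable_fun [set: R] spectral.
Proof.
have m1 := measurable_fubini_F (integrable_damped ltr01).
have E xi : spectral xi = expR `|xi| * fine (fubini_F m2 (EFin \o (fun p : T * T2 =>
    expR (- (1 * `|p.1 : R|)) * (G p.2 * cos (p.1 * del p.2)))) xi).
  by rewrite /fubini_F/= integral_damped_inner/= mul1r expRN mulrA divff ?mul1r// gt_eqF ?expR_gt0.
rewrite (funext E); apply: measurable_funM.
  by apply: (measurableT_comp (@measurable_expR R)); exact: normr_measurable.
exact: (measurableT_comp (fine_measurable measurableT) m1).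
Qed.

Hypothesis spectral_ge0 : forall xi, 0 <= spectral xi.
Hypothesis del_neq0 : {ae m2, forall z, del z != 0}.
Hypothesis iGk : m2.-integrable [set: T2] (EFin \o (fun z => G z * `|del z| `^ (s - 1))).

Let hk (p : T * T2) : R :=
  ppow (s - 1) p.1 * (G p.2 * (2 * p.1 / (p.1 ^+ 2 + del p.2 ^+ 2))).

Lemma measurable_hk : measurable_fun [set: T * T2] hk.
Proof.
apply: measurable_funM; first exact: (measurableT_comp (measurable_ppow _) measurable_fst).
apply: measurable_funM; first exact: (measurableT_comp mG measurable_snd).
apply: measurable_funM; first by apply: measurable_funM => //; exact: measurable_fst.
apply: measurable_inv_nneg; first by move=> z; rewrite addr_ge0 ?sqr_ge0.
apply: measurable_funD; apply: measurable_funX; first exact: measurable_fst.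
exact: (measurableT_comp mdel measurable_snd).
Qed.

Lemma hkE (t : T) (z : T2) : hk (t, z) =
  G z * (ppow (s - 1) t * (2 * t / (t ^+ 2 + del z ^+ 2))).
Proof. by rewrite /hk/= mulrCA. Qed.

Lemma pker_ge0 (t x : R) : 0 <= ppow (s - 1) t * (2 * t / (t ^+ 2 + x ^+ 2)).
Proof.
have [t0|t0] := leP t 0; first by rewrite ppow_le0// mul0r.
rewrite mulr_ge0 ?ppow_ge0// divr_ge0//; first by rewrite mulr_ge0// ltW.
by rewrite addr_ge0 ?sqr_ge0.
Qed.

Lemma measurable_pker (x : R) :
  measurable_fun [set: R] (fun t : R => ppow (s - 1) t * (2 * t / (t ^+ 2 + x ^+ 2))).
Proof.
apply: measurable_funM; first exact: measurable_ppow.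
apply: measurable_funM; first exact: measurable_funM.
apply: measurable_inv_nneg; first by move=> z; rewrite addr_ge0 ?sqr_ge0.
by apply: measurable_funD => //; exact: measurable_funX.
Qed.

(** Integrating the absolute value over t first gives [cauconst s] times |G| |del|^(s-1) wherever
    del is nonzero, hence almost everywhere, and [iGk] makes this integrable. *)
Lemma integrable_hk : (mu \x m2)%E.-integrable [set: T * T2] (EFin \o hk).
Proof.
apply/integrable21ltyP; first by apply/measurable_EFinP; exact: measurable_hk.
have mabs : measurable_fun [set: T * T2] (fun p => `|(EFin \o hk) p|%E).
  by apply: measurableT_comp => //; apply/measurable_EFinP; exact: measurable_hk.
rewrite (@ge0_ae_eq_integral _ _ _ m2 _ _
  (fun z => (cauconst s)%:E * `|(G z * `|del z| `^ (s - 1))%:E|)%E)//.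
- rewrite ge0_integralZl_EFin//.
  + apply: lte_mul_pinfty => //; first by rewrite lee_fin ltW// cauconst_gt0.
    by have /integrableP[] := iGk.
  + by apply: measurableT_comp => //; exact: measurable_int iGk.
  + by rewrite ltW// cauconst_gt0.
- exact: (measurable_fun_fubini_tonelli_G (fun p => `|(EFin \o hk) p|%E)).
- apply: emeasurable_funM => //.
  by apply: measurableT_comp => //; exact: measurable_int iGk.
- by move=> z _; exact: integral_ge0.
- by move=> z _; rewrite mule_ge0// lee_fin ltW// cauconst_gt0.
- apply: filterS del_neq0 => z dz _.
  under eq_integral => t _ do rewrite /= hkE normrM (ger0_norm (pker_ge0 _ _)) EFinM.
  rewrite ge0_integralZl_EFin//.
  + rewrite integral_cauker_scaled// -!EFinM normrM [X in _ * (_ * X)]ger0_norm ?powR_ge0//.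
    by congr EFin; rewrite mulrCA.
  + by move=> t _; rewrite lee_fin pker_ge0.
  + by apply/measurable_EFinP; exact: measurable_pker.
Qed.

(** The exchange of xi and t is Tonelli's, through [spectral_ge0]; the exchange of t and z is
    Fubini's, through [integrable_hk]. All steps are equalities except the pointwise comparison at
    xi = 0. *)
Lemma spectral_le :
  ((Gamma s)%:E * \int[mu]_xi (`|xi| `^ (- s) * spectral xi)%:E <=
   (cauconst s * Rintegral m2 [set: T2] (fun z => G z * `|del z| `^ (s - 1)))%:E)%E.
Proof.
have mpn : measurable_fun [set: R] (fun xi : R => `|xi| `^ (- s)).
  by apply: (measurableT_comp (measurable_powR _)); exact: normr_measurable.
pose f (p : T * T) : \bar R :=
  (ppow (s - 1) p.2 * expR (- (p.2 * `|p.1 : R|)) * spectral p.1)%:E.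
have f0 p : (0 <= f p)%E by rewrite lee_fin mulr_ge0// mulr_ge0 ?expR_ge0//; exact: ppow_ge0.
have mf : measurable_fun [set: T * T] f.
  apply/measurable_EFinP; apply: measurable_funM; last first.
    exact: (measurableT_comp measurable_spectral measurable_fst).
  apply: measurable_funM; first exact: (measurableT_comp (measurable_ppow _) measurable_snd).
  apply: (measurableT_comp (@measurable_expRN R)); apply: measurable_funM; first exact: measurable_snd.
  exact: (measurableT_comp (@normr_measurable _ _) measurable_fst).
rewrite -ge0_integralZl_EFin//; last 3 first.
- by move=> xi _; rewrite lee_fin mulr_ge0 ?powR_ge0.
- by apply/measurable_EFinP; apply: measurable_funM => //; exact: measurable_spectral.
- by rewrite ltW// Gamma_gt0.
apply: (@le_trans _ _ (\int[mu]_xi \int[mu]_t f (xi, t))%E).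
  apply: ge0_le_integral => //.
  - by move=> xi _; rewrite -EFinM lee_fin !mulr_ge0 ?powR_ge0// ltW// Gamma_gt0.
  - apply: emeasurable_funM => //.
    by apply/measurable_EFinP; apply: measurable_funM => //; exact: measurable_spectral.
  - exact: (measurable_fun_fubini_tonelli_F f).
  (* At xi = 0 the power 0^(-s) is 0 by convention, while the integral over t on the other side is
     merely known to be nonnegative. *)
  - move=> xi _; have [->|xi0] := eqVneq xi 0.
      rewrite normr0 powR0 ?mul0r ?mule0; last by rewrite oppr_eq0 gt_eqF//; case/andP: s01.
      exact: integral_ge0.
    rewrite /f/=; under eq_integral => t _ do rewrite EFinM.
    rewrite ge0_integralZr//.
    + by rewrite integral_gamker_scaled// -!EFinM mulrA.
    + apply/measurable_EFinP; apply: measurable_funM; first exact: measurable_ppow.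
      by apply: (measurableT_comp (@measurable_expRN R)); exact: measurable_funM.
    + by move=> t _; rewrite lee_fin mulr_ge0 ?ppow_ge0 ?expR_ge0.
    + by rewrite lee_fin.
rewrite (fubini_tonelli f)//.
rewrite le_eqVlt; apply/orP; left; apply/eqP.
transitivity (\int[mu]_t \int[m2]_z (EFin \o hk) (t, z))%E.
  (* The Poisson formula needs t > 0; for t <= 0 the factor [ppow] makes both sides vanish. *)
  apply: eq_integral => t _; have [t0|t0] := leP t 0.
    rewrite /f/=; under eq_integral do rewrite ppow_le0// !mul0r.
    rewrite integral0; apply/esym.
    under eq_integral do rewrite hkE/= ppow_le0// mul0r mulr0.
    by rewrite integral0.
  rewrite /f/=; under eq_integral => xi _ do rewrite -mulrA EFinM.
  rewrite ge0_integralZl_EFin//; last 3 first.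
  + by move=> xi _; rewrite lee_fin mulr_ge0 ?expR_ge0.
  + apply/measurable_EFinP; apply: measurable_funM; last exact: measurable_spectral.
    by apply: continuous_measurable_fun; exact: continuous_expRN_norm.
  + exact: ppow_ge0.
  rewrite integral_damped// /hk/=; under [RHS]eq_integral => z _ do rewrite EFinM.
  rewrite integralZl//; last exact: integrable_poisson.
  rewrite /Rintegral fineK//.
  exact: (integrable_fin_num measurableT (integrable_poisson t0)).
rewrite (Fubini integrable_hk).
have iGk' := integrableZl measurableT (cauconst s) iGk.
transitivity (\int[m2]_z ((cauconst s)%:E * (G z * `|del z| `^ (s - 1))%:E))%E.
  apply: ae_eq_integral => //.
  - exact: (measurable_fubini_G integrable_hk).
  - exact: measurable_int iGk'.
  - apply: filterS del_neq0 => z dz _.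
    under eq_integral => t _ do rewrite /= hkE EFinM.
    rewrite integralZl//.
      by rewrite integral_cauker_scaled// -!EFinM mulrCA.
    apply/integrableP; split; first by apply/measurable_EFinP; exact: measurable_pker.
    under eq_integral do rewrite /= (ger0_norm (pker_ge0 _ _)).
    by rewrite integral_cauker_scaled// ltry.
rewrite integralZl// EFinM; congr (_ * _)%E.
by rewrite /Rintegral fineK//; exact: integrable_fin_num.
Qed.

End Spectral.

(** * Lebesgue measure on the plane *)

Definition leb (R : realType) : {sigma_finite_measure set (measurableTypeR R) -> \bar R} :=
  @lebesgue_measure R.

(* The canonical sigma-finite structure on product measures is keyed on
   subprobabilities, hence this separate copy of the product. *)
Definition sqleb (R : realType) : set (measurableTypeR R * measurableTypeR R)%type -> \bar R :=
  (leb R \x leb R)%E.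
Arguments sqleb : clear implicits.

HB.instance Definition _ (R : realType) := Measure.on (sqleb R).

Lemma sqleb_sigma_finite (R : realType) : sigma_finite setT (sqleb R).
Proof.
pose I n : set R := `[- n%:R, n%:R]%classic.
exists (fun n => I n `*` I n).
  apply/seteqP; split => // -[x y] _.
  exists (maxn (Num.bound `|x|) (Num.bound `|y|)) => //.
  rewrite /I; split; rewrite /= in_itv/= -ler_norml.
    by rewrite (le_trans (ltW (archi_boundP (normr_ge0 x))))// ler_nat leq_maxl.
  by rewrite (le_trans (ltW (archi_boundP (normr_ge0 y))))// ler_nat leq_maxr.
move=> n; split; first by apply: measurableX; exact: measurable_itv.
have mI : (@lebesgue_measure R (I n) < +oo)%E.
  by rewrite lebesgue_measure_itv/=; case: ifPn => // _; rewrite -EFinB ltry.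
rewrite /sqleb product_measure1E; [|exact: measurable_itv|exact: measurable_itv].
by apply: lte_mul_pinfty => //; rewrite ge0_fin_numE.
Qed.

HB.instance Definition _ (R : realType) :=
  Measure_isSigmaFinite.Build _ _ _ (sqleb R) (sqleb_sigma_finite R).

(** * Riesz energy of a bounded function supported in (-1, 1) *)

Section Energy.
Variable R : realType.
Notation mu := (@lebesgue_measure R).
Notation T := (measurableTypeR R).
Notation M := (sqleb R).
Variables (s B : R) (g : R -> R).
Hypothesis s01 : 0 < s < 1.
Hypothesis mg : measurable_fun [set: R] g.
Hypothesis gB : forall x, `|g x| <= B * \1_(`]-1, 1[%classic) x.

Let G (z : T * T) : R := g z.1 * g z.2.
Let del (z : T * T) : R := z.1 - z.2.

Lemma integrable_g : mu.-integrable [set: T] (EFin \o g).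
Proof.
apply: (@le_integrable_EFin _ _ T mu _ _ (\1_(`]-1, 1[%classic)) B) => //.
- exact: integrable_indic_itv.
- by move=> x _; rewrite [X in _ * X]ger0_norm ?gB// indicE ler0n.
Qed.

Lemma measurable_G : measurable_fun [set: T * T] G.
Proof. exact: measurable_tensor. Qed.

Lemma integrable_G : M.-integrable [set: T * T] (EFin \o G).
Proof. exact: (@integrable_tensor _ _ _ _ _ (leb R) (leb R) _ _ integrable_g integrable_g). Qed.

Lemma measurable_del : measurable_fun [set: T * T] del.
Proof.
apply: measurable_funB; [exact: measurable_fst|exact: measurable_snd].
Qed.

Definition Fg (xi : R) : R :=
  (Rintegral mu [set: T] (fun x => g x * cos (xi * x)) / (2 * pi)) ^+ 2
  + (Rintegral mu [set: T] (fun x => g x * sin (xi * x)) / (2 * pi)) ^+ 2.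

Lemma Fg_ge0 xi : 0 <= Fg xi.
Proof. by rewrite addr_ge0 ?sqr_ge0. Qed.

(** By the addition formula cos(xi (x - y)) is a sum of two tensor products, and each double
    integral is a square. *)
Lemma FgE xi : Fg xi = (2 * pi) ^- 2 * spectral M G del xi.
Proof.
have ic : mu.-integrable [set: T] (EFin \o (fun x : T => g x * cos (xi * x))).
  apply: (@le_integrable_EFin _ _ T mu _ _ g 1) => //.
  - apply: measurable_funM => //; apply: (measurableT_comp (@measurable_cos R)).
    exact: measurable_funM.
  - exact: integrable_g.
  - by move=> x _; rewrite mul1r normrM ler_piMr// cos_max.
have is_ : mu.-integrable [set: T] (EFin \o (fun x : T => g x * sin (xi * x))).
  apply: (@le_integrable_EFin _ _ T mu _ _ g 1) => //.
  - apply: measurable_funM => //; apply: (measurableT_comp (@measurable_sin R)).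
    exact: measurable_funM.
  - exact: integrable_g.
  - by move=> x _; rewrite mul1r normrM ler_piMr// sin_max.
have hc := @integral_tensor _ _ _ _ _ (leb R) (leb R) _ _ ic ic.
have hs := @integral_tensor _ _ _ _ _ (leb R) (leb R) _ _ is_ is_.
have tc := @integrable_tensor _ _ _ _ _ (leb R) (leb R) _ _ ic ic.
have ts := @integrable_tensor _ _ _ _ _ (leb R) (leb R) _ _ is_ is_.
have -> : spectral M G del xi =
  Rintegral mu [set: T] (fun x => g x * cos (xi * x)) ^+ 2 +
  Rintegral mu [set: T] (fun x => g x * sin (xi * x)) ^+ 2.
  rewrite !expr2; apply/esym; etransitivity; first exact: (congr2 +%R (esym hc) (esym hs)).
  rewrite -RintegralD//; apply: eq_Rintegral => z _.
  rewrite /G /del mulrBr cosB; ring.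
clear ic is_ hc hs tc ts; rewrite /Fg; move: (Rintegral _ _ _) (Rintegral _ _ _) => a b.
by rewrite !expr_div_n -mulrDl mulrC.
Qed.

(** Positive definiteness of cos(xi (x - y)), read off from the sum of squares. *)
Lemma spectral_G_ge0 xi : 0 <= spectral M G del xi.
Proof.
have p0 : 0 < (2 * pi : R) ^- 2 by rewrite invr_gt0 exprn_gt0// mulr_gt0// pi_gt0.
by rewrite -(pmulr_rge0 _ p0) -FgE Fg_ge0.
Qed.

(** Every vertical section of the diagonal is a single point. *)
Lemma ae_del_neq0 : {ae M, forall z, del z != 0}.
Proof.
exists (del @^-1` [set 0]); split.
- by rewrite -[X in measurable X]setTI; apply: measurable_del.
- change ((\int[leb R]_x (leb R \o xsection (del @^-1` [set 0%R])) x)%E = 0%E).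
  apply: integral0_eq => x _.
  rewrite /= (_ : xsection _ x = [set x]) ?lebesgue_measure_set1//.
  apply/seteqP; split => y /=.
    by rewrite /xsection/= => /set_mem /= /eqP; rewrite /del/= subr_eq0 => /eqP ->.
  by move=> ->; rewrite /xsection/=; apply/mem_set; rewrite /del/= subrr.
- by move=> z /= /negP; rewrite negbK => /eqP.
Qed.

(** The interval [-2, 2] contains all differences of two points of (-1, 1). *)
Lemma riesz_kernel_lty : (\int[mu]_t (\1_(`[-2, 2]%classic) t * `|t| `^ (s - 1))%:E < +oo)%E.
Proof.
have /andP[s0 s1] := s01.
apply: (@ge0_integral_split_fin _ _ `[0, 2]%classic `[-2, 0]%classic
  (fun t => t `^ (s - 1)) (fun t => (0 - t) `^ (s - 1))).
- exact: measurable_itv.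
- exact: measurable_itv.
- apply: measurable_funM; first by apply: measurable_indic; exact: measurable_itv.
  apply: (measurableT_comp (measurable_powR _)); exact: normr_measurable.
- exact: measurable_powR.
- exact: measurable_powRB.
- by move=> t; rewrite mulr_ge0 ?powR_ge0// indicE ler0n.
- by move=> t; exact: powR_ge0.
- by move=> t; exact: powR_ge0.
- move=> t; rewrite !indicE; have [/set_mem/=|tn] := boolP (t \in `[-2, 2]%classic); last first.
    by rewrite mul0r addr_ge0// mulr_ge0 ?powR_ge0// ler0n.
  rewrite in_itv/= => /andP[t1 t2]; rewrite mul1r; have [t0|t0] := leP 0 t.
    have h1 : t \in `[0, 2]%classic by apply/mem_set; rewrite /= in_itv/= t0 t2.
    rewrite ger0_norm// h1 mulr1.
    by rewrite lerDl mulr_ge0 ?powR_ge0// ler0n.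
  have h1 : t \in `[-2, 0]%classic by apply/mem_set; rewrite /= in_itv/= t1 (ltW t0).
  rewrite ltr0_norm// sub0r h1 mulr1.
  by rewrite lerDr mulr_ge0 ?powR_ge0// ler0n.
- by rewrite integral_powR// ltry.
- by rewrite integral_powR_lend// ?ltry// lerNl oppr0.
Qed.

(** Once the kernel is cut off to [-2, 2], its integral over y no longer depends on x, by reflection
    and translation; what remains is a multiple of the indicator of (-1, 1). *)
Lemma integrable_riesz : M.-integrable [set: T * T] (EFin \o (fun z => G z * `|del z| `^ (s - 1))).
Proof.
set kk := fun t : R => \1_(`[-2, 2]%classic) t * `|t| `^ (s - 1).
have mk : measurable_fun [set: R] (fun t : R => `|t| `^ (s - 1)).
  apply: (measurableT_comp (measurable_powR _)); exact: normr_measurable.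
have mkk : measurable_fun [set: R] kk.
  by apply: measurable_funM => //; apply: measurable_indic; exact: measurable_itv.
have kk0 t : 0 <= kk t by rewrite mulr_ge0 ?powR_ge0// indicE ler0n.
apply/(@integrable12ltyP _ _ _ _ _ (leb R) (leb R)).
  apply/measurable_EFinP; apply: measurable_funM; first exact: measurable_G.
  exact: (measurableT_comp mk measurable_del).
pose h (x : R) : R := B ^+ 2 * \1_(`]-1, 1[%classic) x.
have h0 x : 0 <= h x by rewrite mulr_ge0 ?sqr_ge0// indicE ler0n.
have mh : measurable_fun [set: R] h.
  apply: measurable_funM; first exact: measurable_cst.
  by apply: measurable_indic; exact: measurable_itv.
have E x : (\int[mu]_y (kk (-1 * y + x))%:E = \int[mu]_t (kk t)%:E)%E.
  have := @ge0_integral_affine R (-1) x (EFin \o kk).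
  rewrite normrN1 invr1 mul1e; apply.
  - by rewrite oppr_eq0 oner_eq0.
  - exact/measurable_EFinP.
  - by move=> t; rewrite /= lee_fin.
apply: (@le_lt_trans _ _ (\int[mu]_x ((h x)%:E * \int[mu]_t (kk t)%:E))%E).
  apply: ge0_le_integral => //.
  - by move=> x _; exact: integral_ge0.
  - apply: (measurable_fun_fubini_tonelli_F (fun z : T * T => `|(G z * `|del z| `^ (s - 1))%:E|%E)).
      apply: measurableT_comp => //; apply/measurable_EFinP.
      apply: measurable_funM; first exact: measurable_G.
      exact: (measurableT_comp mk measurable_del).
    by [].
  - by apply: emeasurable_funM => //; exact/measurable_EFinP.
  - move=> x _; rewrite -(E x) -ge0_integralZl_EFin//; last 2 first.
    + by move=> y _; rewrite lee_fin.
    + apply/measurable_EFinP; apply: (measurableT_comp mkk).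
      exact: measurable_affine.
    apply: ge0_le_integral => //.
    + apply: measurableT_comp => //; apply/measurable_EFinP.
      apply: (measurableT_comp (f := fun z : T * T => G z * `|del z| `^ (s - 1))); last exact: pair1_measurable.
      apply: measurable_funM; first exact: measurable_G.
      exact: (measurableT_comp mk measurable_del).
    + apply: emeasurable_funM => //; apply/measurable_EFinP; apply: (measurableT_comp mkk).
      exact: measurable_affine.
    + move=> y _ /=; rewrite -EFinM lee_fin /G /del/= /h /kk mulN1r addrC.
      rewrite !normrM (ger0_norm (powR_ge0 _ _)) mulrA ler_wpM2r ?powR_ge0//.
      have := gB x; have := gB y; rewrite !indicE.
      have [/set_mem/= xi|_] := boolP (x \in `]-1, 1[%classic); last first.
        by rewrite mulr0 => _ gx; rewrite !mulr0 mul0r (le_trans (ler_wpM2r _ gx))// mul0r.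
      have [/set_mem/= yi|_] := boolP (y \in `]-1, 1[%classic); last first.
        by rewrite mulr0 => gy _; rewrite (le_trans (ler_wpM2l _ gy))// mulr0 mulr_ge0 ?ler0n// mulr1 sqr_ge0.
      move=> gy gx; rewrite mem_set ?mulr1.
        by rewrite expr2; rewrite !mulr1 in gx gy; exact: ler_pM.
      move: xi yi; rewrite /= !in_itv/= => /andP[? ?] /andP[? ?]; apply/andP; split; lra.
rewrite ge0_integralZr//.
- apply: lte_mul_pinfty.
  + by apply: integral_ge0 => x _; rewrite lee_fin.
  + have := integrableZl measurableT (B ^+ 2) (@integrable_indic_itv R (-1) 1 false true).
    by move=> /(integrable_fin_num measurableT).
  + exact: riesz_kernel_lty.
- exact/measurable_EFinP.
- by move=> x _; rewrite lee_fin.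
- by apply: integral_ge0 => x _; rewrite lee_fin.
Qed.

Lemma energy_le :
  ((Gamma s)%:E * \int[mu]_xi (`|xi| `^ (- s) * Fg xi)%:E <=
   ((2 * pi) ^- 2 * (cauconst s * Rintegral M [set: T * T] (fun z => G z * `|del z| `^ (s - 1))))%:E)%E.
Proof.
have p0 : 0 < (2 * pi : R) ^- 2 by rewrite invr_gt0 exprn_gt0// mulr_gt0// pi_gt0.
have mpn : measurable_fun [set: R] (fun xi : R => `|xi| `^ (- s)).
  by apply: (measurableT_comp (measurable_powR _)); exact: normr_measurable.
have ms : measurable_fun [set: R] (spectral M G del).
  by apply: measurable_spectral; [exact: integrable_G|exact: measurable_del].
have H := spectral_le s01 integrable_G measurable_del spectral_G_ge0 ae_del_neq0 integrable_riesz.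
rewrite EFinM; apply: le_trans (lee_wpmul2l _ H); last by rewrite lee_fin ltW.
rewrite le_eqVlt; apply/orP; left; apply/eqP; rewrite muleCA; congr (_ * _)%E.
rewrite -[RHS]ge0_integralZl_EFin//.
- by apply: eq_integral => xi _; rewrite FgE -EFinM mulrCA.
- by move=> xi _; rewrite lee_fin mulr_ge0 ?powR_ge0// spectral_G_ge0.
- by apply/measurable_EFinP; exact: measurable_funM.
- exact: ltW.
Qed.

(** [kl] and [kr] are the two sides of the diagonal; they come from the left and the right
    fractional integral respectively. *)
Let kl (z : T * T) : R := G z * ppow (s - 1) (z.1 - z.2).
Let kr (z : T * T) : R := G z * ppow (s - 1) (z.2 - z.1).

Lemma ppow_le_norm (a t : R) : ppow a t <= `|t| `^ a.
Proof.
have [t0|t0] := leP t 0; first by rewrite ppow_le0// powR_ge0.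
by rewrite ppow_gt0// gtr0_norm.
Qed.

Lemma integrable_lriesz : M.-integrable [set: T * T] (EFin \o kl).
Proof.
apply: (le_integrable_EFin (B := 1) _ _ integrable_riesz) => //.
- apply: measurable_funM; first exact: measurable_G.
  exact: (measurableT_comp (measurable_ppow _) measurable_del).
- move=> z _; rewrite mul1r normrM [leRHS]normrM ler_wpM2l//.
  rewrite (ger0_norm (ppow_ge0 _ _)) (ger0_norm (powR_ge0 _ _)).
  exact: ppow_le_norm.
Qed.

Lemma integrable_rriesz : M.-integrable [set: T * T] (EFin \o kr).
Proof.
apply: (le_integrable_EFin (B := 1) _ _ integrable_riesz) => //.
- apply: measurable_funM; first exact: measurable_G.
  apply: (measurableT_comp (measurable_ppow _)).
  by apply: measurable_funB; [exact: measurable_snd|exact: measurable_fst].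
- move=> z _; rewrite mul1r normrM [leRHS]normrM ler_wpM2l//.
  rewrite (ger0_norm (ppow_ge0 _ _)) (ger0_norm (powR_ge0 _ _)).
  by rewrite /del distrC; exact: ppow_le_norm.
Qed.

(** Exchanging x and y maps one half of the kernel to the other and leaves g(x) g(y) unchanged; the
    two orders of iterated integration realise the exchange. *)
Lemma Rintegral_lriesz_rriesz : Rintegral M [set: T * T] kl = Rintegral M [set: T * T] kr.
Proof.
rewrite /Rintegral; congr fine.
have h1 := @integral12_prod_meas1 _ _ _ _ _ (leb R) (leb R) _ integrable_lriesz.
have h2 := @integral21_prod_meas1 _ _ _ _ _ (leb R) (leb R) _ integrable_rriesz.
rewrite -[LHS]h1 -[RHS]h2; apply: eq_integral => x _.
rewrite /fubini_F /fubini_G; apply: eq_integral => y _.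
by rewrite /= /kl /kr /G/= (mulrC (g x)).
Qed.

Lemma Rintegral_riesz : Rintegral M [set: T * T] (fun z => G z * `|del z| `^ (s - 1)) =
  2 * Rintegral M [set: T * T] kl.
Proof.
rewrite mulr_natl mulr2n {2}Rintegral_lriesz_rriesz -RintegralD//; last 2 first.
- exact: integrable_lriesz.
- exact: integrable_rriesz.
apply: eq_Rintegral => z _; rewrite /kl /kr -mulrDr; congr (_ * _).
rewrite /del; have [z0|z0|z0] := ltgtP (z.1 : R) z.2.
- rewrite (@ppow_le0 _ _ (z.1 - z.2)) ?subr_le0 ?(ltW z0)// ppow_gt0 ?subr_gt0// add0r.
  by rewrite distrC gtr0_norm ?subr_gt0.
- rewrite (@ppow_le0 _ _ (z.2 - z.1)) ?subr_le0 ?(ltW z0)// ppow_gt0 ?subr_gt0// addr0.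
  by rewrite gtr0_norm ?subr_gt0.
(* On the diagonal all three terms are 0, since s - 1 is nonzero and 0 to a nonzero power is 0. *)
- rewrite z0 subrr !ppow_le0// normr0 powR0 ?addr0//.
  by rewrite subr_eq0 lt_eqF//; case/andP: s01.
Qed.

Lemma Rintegral_sq (f : T * T -> R) : M.-integrable [set: T * T] (EFin \o f) ->
  Rintegral M [set: T * T] f =
  fine (\int[mu]_x \int[mu]_y (f (x, y))%:E)%E.
Proof.
move=> fi; rewrite /Rintegral; congr fine.
by rewrite -[LHS](@integral12_prod_meas1 _ _ _ _ _ (leb R) (leb R) _ fi).
Qed.

End Energy.

(** * Fractional integrals paired with a polynomial as halves of its Riesz energy *)

Section Caputo.
Variable R : realType.
Notation mu := (@lebesgue_measure R).
Notation T := (measurableTypeR R).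
Variables (s : R) (w : {poly R}).
Hypothesis s01 : 0 < s < 1.

Definition cut (x : R) : R := w.[x] * \1_(`]-1, 1[%classic) x.

Lemma cut_in (x : R) : -1 < x < 1 -> cut x = w.[x].
Proof. by move=> x1; rewrite /cut indicE mem_set ?mulr1. Qed.

Lemma cut_out (x : R) : ~~ (-1 < x < 1) -> cut x = 0.
Proof. by move=> /negP x1; rewrite /cut indicE memNset ?mulr0. Qed.

Lemma measurable_cut : measurable_fun [set: R] cut.
Proof.
apply: measurable_funM; first exact: measurable_poly.
by apply: measurable_indic; exact: measurable_itv.
Qed.

Lemma cut_bounded : exists B, forall x, `|cut x| <= B * \1_(`]-1, 1[%classic) x.
Proof.
have [B B0 HB] := poly_bounded w; exists B => x; rewrite /cut normrM indicE.
have [/set_mem/=|_] := boolP (x \in `]-1, 1[%classic); last by rewrite normr0 !mulr0.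
by rewrite in_itv/= normr1 !mulr1 => /andP[? ?]; rewrite HB// !ltW.
Qed.

Lemma Rintegral_cut (f : R -> R) :
  Rintegral mu [set: T] (fun x => cut x * f x) = Rintegral mu `]-1, 1[ (fun x => w.[x] * f x).
Proof.
rewrite [RHS]Rintegral_mkcond; apply: eq_Rintegral => x _; rewrite patchE /cut indicE.
by case: ifPn => _; rewrite ?mulr1// mulr0 mul0r.
Qed.

Lemma Fg_cut xi : Fg cut xi = Fc_abs2 (fun x => w.[x]) xi.
Proof. by rewrite /Fg !Rintegral_cut. Qed.

(** The interval is open because [cut] vanishes at -1 and [ppow] at 0; the endpoints are restored,
    as null sets, in [Rintegral_restrict]. *)
Lemma lker_patch (x y : R) : -1 < x < 1 ->
  cut y * ppow (s - 1) (x - y) = ((fun y => (x - y) `^ (s - 1) * w.[y]) \_ `]-1, x[) y.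
Proof.
move=> /andP[x0 x1]; rewrite patchE mem_setE in_itv/=.
have [yx|yx] := ltP y x; last by rewrite andbF ppow_le0 ?mulr0// subr_le0.
rewrite andbT ppow_gt0 ?subr_gt0//; have [y0|y0] := ltP (-1) y.
  by rewrite cut_in ?y0 ?(lt_trans yx)// mulrC.
by rewrite cut_out ?mul0r// negb_and -leNgt y0.
Qed.

Lemma rker_patch (x y : R) : -1 < x < 1 ->
  cut y * ppow (s - 1) (y - x) = ((fun y => (y - x) `^ (s - 1) * w.[y]) \_ `]x, 1[) y.
Proof.
move=> /andP[x0 x1]; rewrite patchE mem_setE in_itv/=.
have [yx|yx] := ltP x y; last by rewrite ppow_le0 ?mulr0// subr_le0.
rewrite /= ppow_gt0 ?subr_gt0//; have [y0|y0] := ltP y 1.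
  by rewrite cut_in ?y0 ?(lt_trans x0)// mulrC.
by rewrite cut_out ?mul0r// negb_and -!leNgt y0 orbT.
Qed.

Lemma Rintegral_restrict (a b : R) (f h : R -> R) :
  (forall y, h y = (f \_ `]a, b[) y) -> mu.-integrable `[a, b] (EFin \o f) ->
  mu.-integrable [set: T] (EFin \o h) /\
  (\int[mu]_y (h y)%:E = (Rintegral mu `[a, b] f)%:E)%E.
Proof.
move=> hf fi.
have hE : EFin \o h = (EFin \o f) \_ `]a, b[.
  by apply/funext => y; rewrite /= hf !patchE; case: ifPn.
have fo : mu.-integrable `]a, b[ (EFin \o f).
  by apply: integrableS fi => //; exact: subset_itvW.
split; first by rewrite hE; exact: (@integrable_mkcond _ T R mu _ (EFin \o f) (measurable_itv _)).1 fo.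
have -> : (\int[mu]_y (h y)%:E = \int[mu]_(y in `]a, b[) (f y)%:E)%E.
  by rewrite [RHS]integral_mkcond -[LHS]/(\int[mu]_y (EFin \o h) y)%E hE.
rewrite fineK; last by apply: integrable_fin_num.
rewrite (@integral_itv_bndoo _ _ _ _ true false)//.
exact: measurable_int fo.
Qed.

Let s0 : 0 < s. Proof. by case/andP: s01. Qed.

Lemma ip_lker : ip (fun x => Rintegral mu `[-1, x] (fun y => (x - y) `^ (s - 1) * w.[y]))
    (fun x => w.[x]) =
  Rintegral (sqleb R) [set: T * T] (fun z => cut z.1 * cut z.2 * ppow (s - 1) (z.1 - z.2)).
Proof.
have [B HB] := cut_bounded.
rewrite Rintegral_sq; last exact: (integrable_lriesz s01 measurable_cut HB).
rewrite /ip /Rintegral integral_mkcond; congr fine; apply: eq_integral => x _.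
rewrite patchE mem_setE in_itv/=; case: ifPn => x1; last first.
  by apply/esym; under eq_integral do rewrite /= (cut_out x1) !mul0r; rewrite integral0.
have x01 : -1 <= x <= 1 by case/andP: x1 => ? ?; rewrite !ltW.
have [i e] := Rintegral_restrict (fun y => lker_patch y x1) (integrable_lker w s0 x01).
under [RHS]eq_integral => y _ do rewrite /= -mulrA EFinM.
by rewrite integralZl// e -EFinM cut_in// mulrC.
Qed.

Lemma ip_rker : ip (fun x => Rintegral mu `[x, 1] (fun y => (y - x) `^ (s - 1) * w.[y]))
    (fun x => w.[x]) =
  Rintegral (sqleb R) [set: T * T] (fun z => cut z.1 * cut z.2 * ppow (s - 1) (z.2 - z.1)).
Proof.
have [B HB] := cut_bounded.
rewrite Rintegral_sq; last exact: (integrable_rriesz s01 measurable_cut HB).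
rewrite /ip /Rintegral integral_mkcond; congr fine; apply: eq_integral => x _.
rewrite patchE mem_setE in_itv/=; case: ifPn => x1; last first.
  by apply/esym; under eq_integral do rewrite /= (cut_out x1) !mul0r; rewrite integral0.
have x01 : -1 <= x <= 1 by case/andP: x1 => ? ?; rewrite !ltW.
have [i e] := Rintegral_restrict (fun y => rker_patch y x1) (integrable_rker w s0 x01).
under [RHS]eq_integral => y _ do rewrite /= -mulrA EFinM.
by rewrite integralZl// e -EFinM cut_in// mulrC.
Qed.

Let I := Rintegral (sqleb R) [set: T * T]
  (fun z => cut z.1 * cut z.2 * ppow (s - 1) (z.1 - z.2)).

(** Left and right fractional integrals have the same quadratic form, so the weights p and 1 - p
    will add up to 1. *)
Lemma ip_rkerE : ip (fun x => Rintegral mu `[x, 1] (fun y => (y - x) `^ (s - 1) * w.[y]))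
    (fun x => w.[x]) = I.
Proof.
have [B HB] := cut_bounded.
by rewrite ip_rker /I (Rintegral_lriesz_rriesz s01 measurable_cut HB).
Qed.

Lemma Jneg_norm2_le :
  ((Gamma s)%:E * Jneg_norm2 (s / 2) (fun x => w.[x]) <=
   ((2 * pi) ^- 2 * (cauconst s * (2 * I)))%:E)%E.
Proof.
have [B HB] := cut_bounded.
rewrite -(Rintegral_riesz s01 measurable_cut HB).
apply: le_trans (energy_le s01 measurable_cut HB).
rewrite /Jneg_norm2 le_eqVlt; apply/orP; left; apply/eqP; congr (_ * _)%E.
apply: eq_integral => xi _; rewrite Fg_cut; congr ((_ * _)%:E).
(* The norm squares |xi|^(-s/2), which gives the |xi|^(-s) of the energy. *)
by rewrite -powR_mulrn ?powR_ge0// -powRrM mulNr divfK.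
Qed.

End Caputo.

(** * Coercivity *)

Lemma sin_pi_lt0 (R : realType) (x : R) : -1 < x < 0 -> sin (pi * x) < 0.
Proof.
move=> /andP[x1 x0]; have p0 := pi_gt0 R.
rewrite -[x]opprK mulrN sinN oppr_lt0; apply: sin_gt0_pi.
by rewrite mulr_gt0 ?oppr_gt0//= -[ltRHS]mulr1 ltr_pM2l// ltrNl.
Qed.

Lemma sin_pi_le0 (R : realType) (x : R) : -1 < x <= 0 -> sin (pi * x) <= 0.
Proof.
move=> /andP[x1]; rewrite le_eqVlt => /predU1P[->|x0]; first by rewrite mulr0 sin0.
by rewrite ltW// sin_pi_lt0 ?x1.
Qed.

(** Numerator and denominator are both negative: m, n and alpha - 2 lie in (-1, 0], where sin(pi x)
    <= 0 with equality only at 0, and m, n cannot both be 0 because their sum is alpha - 2 < 0. *)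
Lemma Calp_gt0 (R : realType) (alpha m n : R) : 1 < alpha -> alpha < 2 ->
  alpha - 2 <= m <= 0 -> alpha - 2 <= n <= 0 -> m + n = alpha - 2 -> 0 < Calp alpha m n.
Proof.
move=> a1 a2 /andP[m0 m1] /andP[n0 n1] mn.
have hd : sin (pi * alpha) < 0.
  rewrite -(_ : sin (pi * (alpha - 2)) = sin (pi * alpha)).
    by apply: sin_pi_lt0; apply/andP; split; lra.
  rewrite mulrBr -(sinD2pi (pi * alpha - pi * 2)) -mulr_natr; congr sin; ring.
rewrite /Calp -mulrNN -invrN; apply: mulr_gt0; last by rewrite invr_gt0 oppr_gt0.
rewrite oppr_gt0; have [m00|m00] := eqVneq m 0.
  rewrite m00 mulr0 sin0 add0r; apply: sin_pi_lt0; apply/andP; split; lra.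
rewrite -[ltRHS]addr0; apply: ltr_leD.
  by apply: sin_pi_lt0; apply/andP; split; [lra|rewrite lt_neqAle m00].
by apply: sin_pi_le0; rewrite n1 andbT; lra.
Qed.

Section Coercive.
Variable R : realType.
Notation mu := (@lebesgue_measure R).
Notation T := (measurableTypeR R).

Lemma caputoD_poly (alpha p m n : R) (u : {poly R}) : alpha < 2 ->
  exists Q : {poly R} * {poly R}, forall x, -1 <= x <= 1 ->
  caputoD alpha p m n u x = (x + 1) `^ (2 - alpha) * Q.1.[x] + (1 - x) `^ (2 - alpha) * Q.2.[x].
Proof.
move=> a2; have s0 : 0 < 2 - alpha by rewrite subr_gt0.
have [q1 H1] := lfrac_poly u^`() s0; have [q2 H2] := rfrac_poly u^`() s0.
pose c := Calp alpha m n; pose ga := (Gamma (2 - alpha))^-1.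
exists ((c * p * ga) *: q1, (c * (1 - p) * ga) *: q2) => x x1 /=.
rewrite /caputoD /lfrac_int /rfrac_int H1// H2// !hornerZ -/c -/ga; ring.
Qed.

Lemma APform_reduce (alpha p m n c rhom rhop : R) (N : nat) (Qm Qp : R -> R) (u v : {poly R}) :
  alpha < 2 ->
  (forall x : R, rhom * Qm x =
     - \sum_(0 <= k < N.+1) (gamma00 R k)^-1 * (legendre R k).[x] * (legendre R k).[-1]) ->
  (forall x : R, rhop * Qp x =
     \sum_(0 <= k < N.+1) (gamma00 R k)^-1 * (legendre R k).[x] * (legendre R k).[1]) ->
  (size v <= N.+1)%N ->
  APform alpha p m n c rhom rhop Qm Qp u v =
    ip (caputoD alpha p m n u) (fun x => v^`().[x]) + c * ip (fun x => u.[x]) (fun x => v.[x]).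
Proof.
move=> a2 hm hp sv; have [Q DE] := @caputoD_poly alpha p m n u a2.
have s0 : 0 < 2 - alpha by rewrite subr_gt0.
(* The left penalty carries the opposite sign of the reproducing kernel, so it contributes -D(-1)
   v(-1) against the +D(-1) v(-1) left by integration by parts. *)
have em : - rhom * ip Qm (fun x => v.[x]) = v.[-1].
  by apply: (ip_legendre_penalty sv) => x; rewrite mulNr hm opprK.
have ep := ip_legendre_penalty sv hp.
rewrite /APform (ip_derive1_parts v s0 DE) -{}ep -{}em.
move: (ip _ _) (ip _ _) (ip _ _) (ip _ _) (caputoD _ _ _ _ _ 1) (caputoD _ _ _ _ _ (-1)).
clear; move=> i1 i2 i3 i4 d1 d2; ring.
Qed.

Lemma integrable_frac_poly (s : R) (f : R -> R) (q v : {poly R}) : 0 < s ->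
  (forall x, -1 <= x <= 1 -> f x = (x + 1) `^ s * q.[x]) \/
  (forall x, -1 <= x <= 1 -> f x = (1 - x) `^ s * q.[x]) ->
  mu.-integrable `]-1, 1[ (EFin \o (fun x => f x * v.[x])).
Proof.
move=> s0 H; have s1 : 0 < s + 1 by rewrite addr_gt0.
case: H => H.
  have := integrable_lparts (q * v) s1; rewrite addrK.
  apply: eq_integrable => // x; rewrite inE/= in_itv/= => /andP[x0 x1].
  by rewrite H ?ltW// hornerM mulrA.
have := integrable_rparts (q * v) s1; rewrite addrK.
apply: eq_integrable => // x; rewrite inE/= in_itv/= => /andP[x0 x1].
by rewrite H ?ltW// hornerM mulrA.
Qed.

Lemma ip_caputoD (alpha p m n : R) (u : {poly R}) : 1 < alpha -> alpha < 2 ->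
  ip (caputoD alpha p m n u) (fun x => u^`().[x]) =
  Calp alpha m n / Gamma (2 - alpha) * Rintegral (sqleb R) [set: T * T]
    (fun z => cut u^`() z.1 * cut u^`() z.2 * ppow (2 - alpha - 1) (z.1 - z.2)).
Proof.
move=> a1 a2; set s := 2 - alpha; have s0 : 0 < s by rewrite subr_gt0.
have s01 : 0 < s < 1 by rewrite s0/= /s ltrBlDr -ltrBlDl; lra.
set w := u^`(); set c := Calp alpha m n; set I := Rintegral _ _ _.
pose fl x := Rintegral mu `[-1, x] (fun y => (x - y) `^ (s - 1) * w.[y]).
pose fr x := Rintegral mu `[x, 1] (fun y => (y - x) `^ (s - 1) * w.[y]).
have il : Rintegral mu `]-1, 1[ (fun x => fl x * w.[x]) = I := ip_lker w s01.
have ir : Rintegral mu `]-1, 1[ (fun x => fr x * w.[x]) = I := ip_rkerE w s01.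
have [q1 H1] := lfrac_poly w s0; have [q2 H2] := rfrac_poly w s0.
have jl := @integrable_frac_poly s fl q1 w s0 (or_introl H1).
have jr := @integrable_frac_poly s fr q2 w s0 (or_intror H2).
transitivity (Rintegral mu `]-1, 1[ (fun x =>
   (c * p / Gamma s) * (fl x * w.[x]) + (c * (1 - p) / Gamma s) * (fr x * w.[x]))).
  apply: eq_Rintegral => x _; rewrite /caputoD /lfrac_int /rfrac_int -/s -/w -/(fl x) -/(fr x) -/c.
  move: (fl x) (fr x) => a b; ring.
rewrite RintegralD//; last 2 first.
- exact: (integrableZl _ (c * p / Gamma s) jl).
- exact: (integrableZl _ (c * (1 - p) / Gamma s) jr).
rewrite (@RintegralZl _ T R mu _ _ _ (measurable_itv _) jl).
rewrite (@RintegralZl _ T R mu _ _ _ (measurable_itv _) jr) il ir.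
(* Both pairings equal I, so p I + (1 - p) I = I. *)
clearbody I c; move: (Gamma s) => ga; clear; ring.
Qed.

Lemma ip_sqr_ge0 (u : {poly R}) : 0 <= ip (fun x => u.[x]) (fun x => u.[x]).
Proof. by apply: Rintegral_ge0 => x _; rewrite -expr2 sqr_ge0. Qed.

End Coercive.

Theorem theorem4p3 (R : realType) (alpha p c m n : R) :
  1 < alpha -> alpha < 2 -> 0 <= p <= 1 -> 0 <= c ->
  alpha - 2 <= m <= 0 -> alpha - 2 <= n <= 0 -> m + n = alpha - 2 ->
  p * sin (pi * m) = (1 - p) * sin (pi * n) ->
  exists C : R, 0 < C /\
  forall (N : nat), (1 <= N)%N ->
  forall (rhom rhop : R) (Qm Qp : R -> R),
  (forall x : R, rhom * Qm x =
     - \sum_(0 <= k < N.+1) (gamma00 R k)^-1 * (legendre R k).[x] * (legendre R k).[-1]) ->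
  (forall x : R, rhop * Qp x =
     \sum_(0 <= k < N.+1) (gamma00 R k)^-1 * (legendre R k).[x] * (legendre R k).[1]) ->
  forall (f : R -> R) (g1 g2 : R) (uN : {poly R}),
  (size uN <= N.+1)%N ->
  (forall v : {poly R}, (size v <= N.+1)%N ->
     APform alpha p m n c rhom rhop Qm Qp uN v
     = ip f (fun x => v.[x]) + g1 * rhom * ip Qm (fun x => v.[x])
       + g2 * rhop * ip Qp (fun x => v.[x])) ->
  (C%:E * Jneg_norm2 (1 - alpha / 2) (fun x => (uN^`()).[x])
     <= (APform alpha p m n c rhom rhop Qm Qp uN uN)%:E)%E.
Proof.
move=> a1 a2 _ c0 hm hn mn _.
have cal0 := Calp_gt0 a1 a2 hm hn mn.
pose s := 2 - alpha.
have s01 : 0 < s < 1 by rewrite subr_gt0 a2/= /s; lra.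
have G0 := Gamma_gt0 s01; have K0 := cauconst_gt0 s01.
have P0 : 0 < (2 * pi : R) ^+ 2 by rewrite exprn_gt0// mulr_gt0// pi_gt0.
have sE : 1 - alpha / 2 = s / 2 by rewrite /s; field.
(* Chosen so that C / Gamma(s) times the bound of [Jneg_norm2_le] is exactly C_{alpha,p} I /
   Gamma(s), the value of (D u, u'). *)
set C := Calp alpha m n * (2 * pi) ^+ 2 / (2 * cauconst s).
have C0 : 0 < C by apply: divr_gt0; apply: mulr_gt0.
exists C; split => // N _ rhom rhop Qm Qp hQm hQp f g1 g2 u su _.
rewrite (APform_reduce _ _ _ _ _ a2 hQm hQp su) (ip_caputoD _ _ _ _ a1 a2) -/s sE.
set I := Rintegral _ _ _.
have H := Jneg_norm2_le u^`() s01; rewrite -/I in H.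
have -> : (C%:E * Jneg_norm2 (s / 2) (fun x => u^`().[x]) =
    (C / Gamma s)%:E * ((Gamma s)%:E * Jneg_norm2 (s / 2) (fun x => u^`().[x])))%E.
  by rewrite muleA -EFinM divfK// gt_eqF.
apply: (le_trans (lee_wpmul2l _ H)); first by rewrite lee_fin ltW// divr_gt0.
(* The reaction term c (u, u) is nonnegative and is dropped; the remaining comparison is an
   equality. *)
rewrite -EFinM lee_fin; apply: (@le_trans _ _ (Calp alpha m n / Gamma s * I)); last first.
  by rewrite lerDl mulr_ge0// ip_sqr_ge0.
rewrite le_eqVlt; apply/orP; left; apply/eqP; rewrite /C.
have q0 : (2 * pi) ^+ 2 != 0 :> R by rewrite gt_eqF.
have g0 : Gamma s != 0 by rewrite gt_eqF.
have k0 : cauconst s != 0 by rewrite gt_eqF.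
clear H; move: (Gamma s) (cauconst s) (Calp _ _ _) (_ ^+ 2) I g0 k0 q0; clear.
by move=> ga ka ca q I g0 k0 q0; field; rewrite g0 k0 q0.
Qed.
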